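(* Let $X$ be a semi-Kelley chainable continuum. Then $X$ is a semi-Kelley remainder.
   Context: A continuum is a compact connected metric space with more than one point. A subcontinuum of a continuum $X$ is a non-empty compact connected subset of $X$ (one-point sets are allowed). Convergence of subcontinua is with respect to the Hausdorff metric. A chain in $X$ is a non-empty finite collection $\mathcal C=\{U_1,\dots,U_n\}$ of non-empty open sets of $X$ such that $U_i\cap U_j\neq\emptyset$ if and only if $|i-j|\leq 1$. For $\varepsilon>0$, $\mathcal C$ is an $\varepsilon$-chain if $\max\{\mathrm{diam}(U_i):1\leq i\leq n\}<\varepsilon$. A continuum $X$ is chainable if for each $\varepsilon>0$ there is an $\varepsilon$-chain covering $X$. A compactification of $(0,1]$ with remainder $R$ is a continuum $Y=(0,1]\cup R$, where $(0,1]$ (a subspace homeomorphic to the half-open interval) is dense in $Y$ and $R$ and $(0,1]$ are disjoint. A continuum $X$ is a semi-Kelley remainder if it is (up to homeomorphism) the remainder of some compactification of $(0,1]$ which is a semi-Kelley continuum. Let $K$ be a subcontinuum of a continuum $Z$. A maximal limit continuum of $K$ is a subcontinuum $M\subset K$ for which there is a sequence $\{M_n\}_{n=1}^\infty$ of subcontinua of $Z$ converging to $M$ such that for each convergent sequence $\{M_n'\}_{n=1}^\infty$ of subcontinua of $Z$ with $M_n\subset M_n'$ for each $n\in\mathbb N$ and $\lim M_n'=M'\subset K$, we have $M'=M$. A continuum $Z$ is semi-Kelley if for each subcontinuum $K$ of $Z$ and every two maximal limit continua $L$ and $M$ of $K$, either $L\subset M$ or $M\subset L$. *)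

(* Defs.v *)
From HB Require Import structures.
From mathcomp Require Import all_boot all_order all_algebra.
From mathcomp Require Import all_classical all_reals all_analysis.

Set Implicit Arguments.
Unset Strict Implicit.
Unset Printing Implicit Defensive.

Import Order.TTheory GRing.Theory Num.Theory.
Import numFieldNormedType.Exports.

Local Open Scope classical_set_scope.
Local Open Scope ring_scope.

(* [f] and [g] are total functions, but only their values on [A] and [B]
   matter: [{within A, continuous f}] is continuity of the restriction. *)
Definition homeomorphic (S T : topologicalType) (A : set S) (B : set T) :=
  exists (f : S -> T) (g : T -> S),
    [/\ {within A, continuous f}, {within B, continuous g},
        f @` A `<=` B, g @` B `<=` A &
        (forall x, A x -> g (f x) = x) /\ (forall y, B y -> f (g y) = y)].

Section continua.
Context (R : realType) (Z : metricType R).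
Implicit Types A B K L M : set Z.

Definition continuum :=
  [/\ compact [set: Z], connected [set: Z] & exists x y : Z, x != y].

Definition subcontinuum K := [/\ K !=set0, compact K & connected K].

Definition neighborhood A (e : R) : set Z := \bigcup_(a in A) ball a e.

(* The infimum is over a non-empty set whenever [A] and [B] are non-empty and
   bounded, in particular when they are subcontinua; it is only used there. *)
Definition hausdorff_dist A B : R :=
  inf [set e | [/\ 0 < e, A `<=` neighborhood B e & B `<=` neighborhood A e]].

Definition hausdorff_cvg (A_ : nat -> set Z) A :=
  hausdorff_dist (A_ n) A @[n --> \oo] --> (0 : R).

(* A genuine diameter only for bounded sets ([sup] is 0 on unbounded ones);
   every subset of a compact metric space is bounded. *)
Definition diam A : R := sup [set mdist p.1 p.2 | p in A `*` A].

Definition chain (n : nat) (U : 'I_n -> set Z) :=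
  [/\ (0 < n)%N,
      forall i, open (U i) /\ U i !=set0 &
      forall i j, U i `&` U j !=set0 <-> `|i%:Z - j%:Z| <= 1].

Definition eps_chain (e : R) (n : nat) (U : 'I_n -> set Z) :=
  chain U /\ forall i, diam (U i) < e.

Definition chainable :=
  continuum /\
  forall e : R, 0 < e -> exists (n : nat) (U : 'I_n -> set Z),
    eps_chain e U /\ \bigcup_i U i = [set: Z].

(* Limits are taken among subcontinua, where [hausdorff_dist] separates points;
   hence [M'] is required to be one. *)
Definition maximal_limit_continuum K M :=
  [/\ subcontinuum M, M `<=` K &
      exists M_ : nat -> set Z,
        [/\ forall n, subcontinuum (M_ n), hausdorff_cvg M_ M &
            forall (M'_ : nat -> set Z) (M' : set Z),
              (forall n, subcontinuum (M'_ n)) -> subcontinuum M' ->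
              hausdorff_cvg M'_ M' -> (forall n, M_ n `<=` M'_ n) ->
              M' `<=` K -> M' = M]].

Definition semi_kelley :=
  continuum /\
  forall K, subcontinuum K -> forall L M,
    maximal_limit_continuum K L -> maximal_limit_continuum K M ->
    L `<=` M \/ M `<=` L.

(* [Z] is a compactification of (0, 1] with remainder [Rem], where [J] is the
   dense copy of (0, 1] inside [Z]. *)
Definition compactification_Ioc01 (J Rem : set Z) :=
  [/\ continuum, homeomorphic `]0 : R, 1 : R]%classic J, dense J,
      J `|` Rem = [set: Z] & J `&` Rem = set0].

End continua.

Arguments continuum {R} Z.
Arguments chainable {R} Z.
Arguments semi_kelley {R} Z.

Definition semi_kelley_remainder (R : realType) (X : metricType R) :=
  continuum X /\
  exists (Y : metricType R) (J Rem : set Y),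
    [/\ compactification_Ioc01 J Rem, semi_kelley Y &
        homeomorphic [set: X] Rem].

(* Main.v *)
(* Ever finer chains of [X], each traversed backwards and then followed from a
   link inside the first link of its predecessor to its end, yield a sequence
   with vanishing steps and dense tails. Each of its segments is Hausdorff close
   to a subcontinuum [A] of [X], such that every subcontinuum containing [A] is
   close to a prolongation of the segment. The ray that follows this sequence
   compactifies with remainder [X]. In the compactification [Y], the only
   maximal limit continuum of a subcontinuum [K] that meets the ray is [K].
   If [K] lies in [X], then a sequence in [Y] witnessing a maximal limit
   continuum of [K] can be replaced by a sequence of subcontinua of [X]: growths
   of the latter are close to growths of the former. Hence [Y] inherits from [X]
   that the maximal limit continua of [K] are nested. *)

From HB Require Import structures.
Require Import Defs.
From mathcomp Require Import all_boot all_order all_algebra.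
From mathcomp Require Import all_classical all_reals all_analysis.
From mathcomp Require Import zify ring lra.

Set Implicit Arguments.
Unset Strict Implicit.
Unset Printing Implicit Defensive.

Import Order.TTheory GRing.Theory Num.Theory.
Import numFieldNormedType.Exports.

Local Open Scope classical_set_scope.
Local Open Scope ring_scope.

(** * Hausdorff closeness in a compact metric space *)

Section metric_compacta.
Context (R : realType) (T : metricType R).
Implicit Types (A B : set T) (e : R).

(** The shape of the walk answers one obstacle: where a walk turns inside a chain, a growth of [A]
    may go on past the turn, and no prolongation of the segment would follow it. Hence there are
    only two kinds of turning places. One is the last link of a chain, beyond which nothing can
    grow. The other is the passage from the first link of a chain [c] into link [q] of the next
    chain [d]. A growth that continues below link [q] of [d] is then read in [c] instead: it meets
    the first link of [c], so its links in [c] form an initial run, and starting earlier on the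
    descent of [c] covers it.

    Only one direction of shadowing is required: growths of [A] must be matched by prolongations of
    the segment, not conversely. Maximality of a limit in [Y] is tested against those prolongations,
    which is what transfers it to [X].

    Since [X] need not contain arcs, the ray cannot be drawn by joining consecutive points of the
    sequence within [X]. It is built among bounded functions, with the sup metric, next to the
    distance functions of the points of [X]. *)

Definition hclose e A B :=
  (forall a, A a -> exists2 b, B b & mdist a b < e) /\
  (forall b, B b -> exists2 a, A a & mdist a b < e).

Lemma hclose_sym e A B : hclose e A B -> hclose e B A.
Proof.
move=> [h1 h2]; split=> x hx.
  by have [y] := h2 _ hx; exists y; rewrite // metric_sym.
by have [y] := h1 _ hx; exists y; rewrite // metric_sym.
Qed.

Lemma hclose_trans B e1 e2 A C :
  hclose e1 A B -> hclose e2 B C -> hclose (e1 + e2) A C.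
Proof.
move=> [h1 h2] [h3 h4]; split=> x hx.
  have [y hy xy] := h1 _ hx; have [z hz yz] := h3 _ hy.
  by exists z => //; rewrite (le_lt_trans (metric_triangle x y z))// ltrD.
have [y hy xy] := h4 _ hx; have [z hz yz] := h2 _ hy.
by exists z => //; rewrite (le_lt_trans (metric_triangle z y x))// ltrD.
Qed.

Lemma hclose_refl e A : 0 < e -> hclose e A A.
Proof. by move=> e0; split=> x Ax; exists x; rewrite // mdistxx. Qed.

Lemma hclose_le e1 e2 A B : e1 <= e2 -> hclose e1 A B -> hclose e2 A B.
Proof.
move=> e12 [h1 h2]; split=> x hx.
  by have [y hy xy] := h1 _ hx; exists y; rewrite // (lt_le_trans xy).
by have [y hy xy] := h2 _ hx; exists y; rewrite // (lt_le_trans xy).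
Qed.

Lemma hcloseP e A B :
  hclose e A B <-> A `<=` neighborhood B e /\ B `<=` neighborhood A e.
Proof.
split=> -[h1 h2]; split=> x hx.
- by have [y hy xy] := h1 _ hx; exists y; rewrite // ballEmdist/= metric_sym.
- by have [y hy xy] := h2 _ hx; exists y; rewrite // ballEmdist.
- by have [y hy] := h1 _ hx; rewrite ballEmdist/= => xy; exists y; rewrite // metric_sym.
- by have [y hy] := h2 _ hx; rewrite ballEmdist/= => xy; exists y.
Qed.

Lemma mdist_lipschitz (x y z : T) : `|mdist x z - mdist y z| <= mdist x y.
Proof.
rewrite ler_norml lerBlDr metric_triangle andbT lerBrDr addrC lerBlDr.
by rewrite (metric_sym x y) addrC metric_triangle.
Qed.

Lemma lipschitz_continuous (U V : metricType R) (f : U -> V) (k : R) : 0 < k ->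
  (forall x y, mdist (f x) (f y) <= k * mdist x y) -> continuous f.
Proof.
move=> k0 fk x; apply/metricType_numDomainType.cvgrPdist_lt => e e0; near=> y.
rewrite (le_lt_trans (fk _ _))// mulrC -ltr_pdivlMr//.
have : ball x (e / k) y by near: y; apply: nbhsx_ballx; exact: divr_gt0.
by rewrite ballEmdist.
Unshelve. all: by end_near. Qed.

Lemma mdist_continuous (x : T) : continuous (mdist x).
Proof.
apply: (@lipschitz_continuous T R^o (mdist x) 1 ltr01) => y z.
by rewrite mul1r {1}/mdist/= distrC !(metric_sym x); exact: mdist_lipschitz.
Qed.

Lemma compact_mdist_bounded : compact [set: T] ->
  exists2 D : R, 0 < D & forall x y : T, mdist x y <= D.
Proof.
move=> cT; have [[t _]|/set0P/negP/negPn/eqP T0] := pselect ([set: T] !=set0); last first.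
  by exists 1 => // x; have : [set: T] x by []; rewrite T0.
have : compact (mdist t @` [set: T]).
  by apply: continuous_compact => //; exact/continuous_subspaceT/mdist_continuous.
move=> /compact_bounded[M [_ /(_ (M + 1))]]; rewrite ltrDl ltr01 => /(_ isT) MT.
have h x : mdist t x <= M + 1.
  by apply: le_trans (MT (mdist t x) _); [exact: ler_norm|exists x].
exists (1 + ((M + 1) + (M + 1))).
  by rewrite ltr_pwDl// addr_ge0// (le_trans _ (h t))// mdist_ge0.
move=> x y; rewrite (le_trans (metric_triangle x t y))//.
by rewrite (metric_sym x t) (le_trans (lerD (h x) (h y)))// lerDr.
Qed.

(** Compactness bounds the metric, so the set of radii whose infimum is [hausdorff_dist] is never
    empty and the default value of [inf] does not intervene. *)
Lemma hausdorff_cvgP (A_ : nat -> set T) A : compact [set: T] ->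
  (forall n, A_ n !=set0) -> A !=set0 ->
  hausdorff_cvg A_ A <-> forall e, 0 < e -> \forall n \near \oo, hclose e (A_ n) A.
Proof.
move=> cT A_0 A0; pose S n := [set e | [/\ 0 < e, A_ n `<=` neighborhood A e & A `<=` neighborhood (A_ n) e]].
have [D D0 hD] := compact_mdist_bounded cT.
have lbS n : lbound (S n) 0 by move=> e [/ltW].
have S0 n : S n !=set0.
  exists (D + 1); split; first by rewrite addr_gt0.
    move=> x _; have [y Ay] := A0; exists y; rewrite // ballEmdist/=.
    by rewrite (le_lt_trans (hD _ _))// ltrDl.
  move=> x _; have [y Ay] := A_0 n; exists y; rewrite // ballEmdist/=.
  by rewrite (le_lt_trans (hD _ _))// ltrDl.
split=> [h e e0|h].
  have /cvgr0_norm_lt/(_ _ e0) := h; apply: filterS => n /=.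
  rewrite /hausdorff_dist -/(S n) => he.
  have /(inf_lt (S0 n))[d [d0 h1 h2]] : inf (S n) < e by rewrite (le_lt_trans (ler_norm _)).
  by move=> de; apply: (@hclose_le d); [exact: ltW|apply/hcloseP].
apply/cvgr0Pnorm_lt => e e0; have e20 : 0 < e / 2 by rewrite divr_gt0.
near=> n.
have /hcloseP[h1 h2] : hclose (e / 2) (A_ n) A by near: n; exact: h.
rewrite /hausdorff_dist -/(S n) ger0_norm; last by apply: lb_le_inf.
rewrite (@le_lt_trans _ _ (e / 2))//; last by rewrite ltr_pdivrMr// ltr_pMr// ltr1n.
by apply: ge_inf; [exists 0|split].
Unshelve. all: by end_near. Qed.

End metric_compacta.

(** * The cut wire theorem *)

Section cut_wire.
Context (R : realType) (T : metricType R).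
Implicit Types (A B F : set T).

Lemma disjoint_sets A B x : A `&` B = set0 -> A x -> B x -> False.
Proof. by move=> AB Ax Bx; have : (A `&` B) x by []; rewrite AB. Qed.

Lemma connected_open_cover A G1 G2 : connected A -> open G1 -> open G2 ->
  G1 `&` G2 = set0 -> A `<=` G1 `|` G2 -> A `<=` G1 \/ A `<=` G2.
Proof.
move=> cA go1 go2 O12 AO; apply: (@connected_subset _ G1 G2) => //.
split; apply/seteqP; split=> // x [].
  by move=> + O2x => /(_ G2 (open_nbhs_nbhs (conj go2 O2x)))[y []]; exact: disjoint_sets.
move=> O1x /(_ G1 (open_nbhs_nbhs (conj go1 O1x)))[y []].
by move=> O2y O1y; exact: (disjoint_sets O12 O1y O2y).
Qed.

Let separates B1 B2 A := exists G1 G2, [/\ open G1, open G2, G1 `&` G2 = set0,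
  A `<=` G1 `|` G2 & G2 `&` B1 = set0 /\ G1 `&` B2 = set0].

(** The chain condition for Zorn's lemma. If [G1] and [G2] separated what is left after removing the
    whole union, they would cover the compact set [F] together with the members of [W]. These are
    nested, so a single [U] in [W] would suffice, and [F] without [U] would already be separated.
    The filter [G] consists of the final segments of [W]. *)
Let nonseparated_bigcup B1 B2 F (W : set (set T)) : compact F ->
  ~ separates B1 B2 F ->
  W `<=` [set U | open U /\ ~ separates B1 B2 (F `\` U)] -> total_on W subset ->
  open (\bigcup_(U in W) U) /\ ~ separates B1 B2 (F `\` \bigcup_(U in W) U).
Proof.
move=> cF nsF WP totW; split; first by apply: bigcup_open => U /WP[].
have [[U0 WU0]|W0] := pselect (W !=set0); last first.
  suff -> : \bigcup_(U in W) U = set0 by rewrite setD0.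
  by apply/seteqP; split=> // x [U WU _]; apply: W0; exists U.
move=> [G1 [G2 [go1 go2 O12 FO]]] Bs.
pose G := filter_from W (fun U => [set V | W V /\ U `<=` V]).
have FG : ProperFilter G.
  apply: filter_from_proper; last by move=> U WU; exists U; split.
  apply: filter_from_filter; first by exists U0.
  move=> U V WU WV; have [UV|VU] := totW _ _ WU WV.
    by exists V => // X [WX VX]; split; split => //; exact: subset_trans VX.
  by exists U => // X [WX UX]; split; split => //; exact: subset_trans UX.
have : \forall U \near G, F `<=` G1 `|` G2 `|` U.
  move/compact_near_coveringP : cF => /(_ _ G (fun U x => (G1 `|` G2 `|` U) x)).
  apply => x Fx; have [[U WU Ux]|nU] := pselect ((\bigcup_(U in W) U) x).
    exists (U, [set V | W V /\ U `<=` V]); last first.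
      by move=> [y V] /= [Uy [WV UV]]; right; exact: UV.
    split => /=; last by exists U.
    by apply: open_nbhs_nbhs; split => //; case: (WP _ WU).
  exists (G1 `|` G2, setT); last by move=> [y V] /= [h _]; left.
  split => /=; last exact: filterT.
  by apply: open_nbhs_nbhs; split; [exact: openU|exact: FO].
move=> hG; have : \forall U \near G, W U by exists U0 => // V [].
move=> /(filterI hG)/filter_ex[U [FU WU]].
have [_] := WP _ WU; apply; exists G1, G2; split => // x [Fx nUx].
by have [] := FU _ Fx.
Qed.

(** Removing a maximal open [W] leaves a minimal non-separated closed set. It meets [B1] and [B2],
    since otherwise one side of a separation could be empty. It is connected: two closed pieces
    would each be separated by minimality, and cutting these separations down to disjoint
    neighbourhoods of the pieces would combine them into one of the whole. *)
Lemma cut_wire B1 B2 F : compact F -> closed B1 -> closed B2 ->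
  (forall G1 G2, open G1 -> open G2 -> G1 `&` G2 = set0 -> F `<=` G1 `|` G2 ->
     G2 `&` B1 = set0 -> G1 `&` B2 = set0 -> False) ->
  exists2 A, A `<=` F & subcontinuum A /\ (A `&` B1 !=set0 /\ A `&` B2 !=set0).
Proof.
move=> cF cB1 cB2 nsF.
have clF : closed F by apply: compact_closed => //; exact: metric_hausdorff.
have {}nsF : ~ separates B1 B2 F by move=> [G1 [G2 [? ? ? ? []]]]; exact: nsF.
have := @Zorn_bigcup _ [set U | open U /\ ~ separates B1 B2 (F `\` U)].
move=> [W WP Wtot|W [[goW nsW] maxW]]; first exact: nonseparated_bigcup.
have cA : closed (F `\` W) by apply: closedI => //; exact: open_closedC.
have A1 : (F `\` W) `&` B1 !=set0.
  apply/set0P/eqP => A0; apply: nsW; exists set0, (~` B1); split => //.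
  - exact: open0.
  - exact: closed_openC.
  - by rewrite set0I.
  - by move=> x Ax; right => B1x; exact: (disjoint_sets A0 Ax B1x).
  - by rewrite setICl set0I.
have A2 : (F `\` W) `&` B2 !=set0.
  apply/set0P/eqP => A0; apply: nsW; exists (~` B2), set0; split => //.
  - exact: closed_openC.
  - exact: open0.
  - by rewrite setI0.
  - by move=> x Ax; left => B1x; exact: (disjoint_sets A0 Ax B1x).
  - by rewrite setICl set0I.
exists (F `\` W); first exact: subDsetl.
split => //; split; first by have [x []] := A1; exists x.
  exact: (subclosed_compact cA cF (@subDsetl _ _ _)).
apply/connectedP => E [E0 AE [E01 E10]].
have EA b : E b `<=` F `\` W by rewrite AE; case: b => x; [right|left].
have cE b : closed (E b).
  move=> x clx; have : (F `\` W) x by apply: cA; apply: closureS clx; exact: EA.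
  rewrite AE; case: b clx => clx [] // Ex; exfalso.
    exact: (disjoint_sets E10 Ex clx).
  exact: (disjoint_sets E01 clx Ex).
have sE b : separates B1 B2 (E b).
  have -> : E b = F `\` ~` E b.
    by rewrite setDE setCK; apply/seteqP; split=> x; [move=> Ex; split => //; have [] := EA _ _ Ex|case].
  (* The complement of [E b] is open and contains [W] properly, because the other piece is
     non-empty. *)
  apply: contrapT => nsE; apply: (maxW (~` E b)).
    split; first by move=> x Wx Ex; have [] := EA _ _ Ex.
    move=> h; have [x Ex] := E0 (~~ b).
    have [_ nWx] := EA _ _ Ex; apply: nWx; apply: h => Ebx.
    have E01' := separated_disjoint (conj E01 E10).
    case: b {nsE} Ebx Ex => Ex1 Ex0; first exact: disjoint_sets E01' Ex0 Ex1.
    exact: disjoint_sets E01' Ex1 Ex0.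
  by split => //; exact/closed_openC/cE.
have [N0 [N1 [go0 go1 EN0 EN1 N01]]] := (@normal_openP R T).1 pseudometric_normal _ _ (cE false) (cE true)
  (separated_disjoint (conj E01 E10)).
have [G1 [G2 [p1 p2 O12 EO [OB1 OB2]]]] := sE false.
have [Q1 [Q2 [q1 q2 Q12 EQ [QB1 QB2]]]] := sE true.
apply: nsW; exists (N0 `&` G1 `|` N1 `&` Q1), (N0 `&` G2 `|` N1 `&` Q2); split.
- by apply: openU; exact: openI.
- by apply: openU; exact: openI.
- apply/seteqP; split=> // x [[[a b]|[a b]] [[c d]|[c d]]].
  + exact: (disjoint_sets O12 b d).
  + exact: (disjoint_sets N01 a c).
  + exact: (disjoint_sets N01 c a).
  + exact: (disjoint_sets Q12 b d).
- rewrite AE => x [Ex|Ex].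
    by have [] := EO _ Ex; [left; left|right; left]; split => //; exact: EN0.
  by have [] := EQ _ Ex; [left; right|right; right]; split => //; exact: EN1.
- split; apply/seteqP; split=> // x [[[a b]|[a b]] c].
  + exact: (disjoint_sets OB1 b c).
  + exact: (disjoint_sets QB1 b c).
  + exact: (disjoint_sets OB2 b c).
  + exact: (disjoint_sets QB2 b c).
Qed.

End cut_wire.

(** * Chains of links and the subcontinua that follow them *)

Section chains.
Context (R : realType) (X : metricType R).
Implicit Types (A : set X) (e : R).

(* A chain with a point marked in each link; the links of index at least [len]
   are empty, so that membership in a link bounds its index. *)
Record pchain := PChain {
  len : nat; link : nat -> set X; pt : nat -> X;
  len_gt0 : (0 < len)%N;
  link_open : forall i, open (link i);
  link_len : forall i x, link i x -> (i < len)%N;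
  link_pt : forall i, (i < len)%N -> link i (pt i);
  link_adj : forall i j x, link i x -> link j x -> (i <= j.+1)%N;
  link_next : forall i, (i.+1 < len)%N -> link i `&` link i.+1 !=set0;
  link_cover : forall x, exists i, link i x }.
Implicit Type c : pchain.

Definition mesh_lt c e := forall i x y, link c i x -> link c i y -> mdist x y < e.

Lemma mesh_ltW c e1 e2 : e1 <= e2 -> mesh_lt c e1 -> mesh_lt c e2.
Proof. by move=> e12 h i x y hx hy; apply: lt_le_trans e12; exact: h hx hy. Qed.

Lemma chainable_pchain : chainable X -> forall e, 0 < e -> exists c, mesh_lt c e.
Proof.
move=> [[cX _ _] chX] e e0; have [m [U [[[m0 Uo Uadj] Ue] Ucov]]] := chX _ e0.
have [D D0 hD] := compact_mdist_bounded cX.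
(* [x0] is a default mark for the empty links of index at least [m]. *)
have [x0 _] : exists x : X, True by have [_ [x _]] := Uo (Ordinal m0); exists x.
pose V i := [set x | exists2 j : 'I_m, val j = i & U j x].
have p_ i : {x | (i < m)%N -> V i x}.
  have [im|im] := boolP (i < m)%N; last by exists x0.
  apply: cid; have [_ [x Ux]] := Uo (Ordinal im); exists x => _.
  by exists (Ordinal im).
unshelve refine (ex_intro _ (@PChain m V (fun i => proj1_sig (p_ i)) m0 _ _ _ _ _ _) _).
- move=> i; have [im|im] := boolP (i < m)%N.
    rewrite (_ : V i = U (Ordinal im)); first by have [] := Uo (Ordinal im).
    apply/seteqP; split=> x; last by exists (Ordinal im).
    by move=> [j ji Ux]; rewrite (_ : Ordinal im = j)//; apply/val_inj.
  rewrite (_ : V i = set0); first exact: open0.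
  by apply/seteqP; split=> // x [j ji _]; move: im; rewrite -ji ltn_ord.
- by move=> i x [j <- _]; exact: ltn_ord.
- by move=> i im; exact: (proj2_sig (p_ i)).
- move=> i j x [a <- ax] [b <- bx]; have : U a `&` U b !=set0 by exists x.
  by move=> /Uadj /=; lia.
- move=> i im; have [|x [xa xb]] := (Uadj (Ordinal (ltnW im)) (Ordinal im)).2.
    by rewrite /=; lia.
  by exists x; split; [exists (Ordinal (ltnW im))|exists (Ordinal im)].
- move=> x; have : [set: X] x by []; rewrite -Ucov => -[j _ Ux].
  by exists j, j.
- move=> i x y [j ji Ux] [k ki Uy]; apply: le_lt_trans (Ue j).
  apply: ub_le_sup; last first.
    exists (x, y) => //; split => //=.
    by rewrite (_ : j = k)//; apply/val_inj; rewrite ji.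
  by exists D => _ [[a b] _ <-]; exact: hD.
Qed.

Definition meets A c i := A `&` link c i !=set0.

Lemma meetsS A B c i : A `<=` B -> meets A c i -> meets B c i.
Proof. by move=> AB [x [Ax cx]]; exists x; split => //; exact: AB. Qed.

(** If link [j] were missed, the links below it and those above it would be disjoint open sets that
    cut [A]. *)
Lemma connected_meets A c i j k : connected A -> (i <= j <= k)%N ->
  meets A c i -> meets A c k -> meets A c j.
Proof.
move=> cA ijk [x [Ax ix]] [y [Ay ky]]; apply: contrapT => nj.
pose G1 := \bigcup_(l in [set l | (l < j)%N]) link c l.
pose G2 := \bigcup_(l in [set l | (j < l)%N]) link c l.
have G12 : G1 `&` G2 = set0.
  apply/seteqP; split=> // z [[a /= aj az] [b /= jb bz]].
  by have := link_adj bz az; lia.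
have AG : A `<=` G1 `|` G2.
  move=> z Az; have [l lz] := link_cover c z; case: (ltngtP l j) => lj.
  - by left; exists l.
  - by right; exists l.
  - by exfalso; apply: nj; exists z; rewrite -lj.
have nij : (i < j)%N.
  rewrite ltn_neqAle; case/andP: ijk => -> _; rewrite andbT; apply/negP => /eqP ij.
  by apply: nj; exists x; rewrite -ij.
have njk : (j < k)%N.
  rewrite ltn_neqAle; case/andP: ijk => _ ->; rewrite andbT; apply/negP => /eqP ij.
  by apply: nj; exists y; rewrite ij.
have [] := connected_open_cover cA _ _ G12 AG.
- by apply: bigcup_open => l _; exact: link_open.
- by apply: bigcup_open => l _; exact: link_open.
- move=> /(_ _ Ay) G1y; apply: (disjoint_sets G12 G1y); by exists k.
- move=> /(_ _ Ax); apply: (disjoint_sets G12); by exists i.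
Qed.

Lemma connected_span A c : connected A -> A !=set0 ->
  exists r s, (s < len c)%N /\ forall l, meets A c l <-> (r <= l <= s)%N.
Proof.
move=> cA [x Ax]; have [l0 l0x] := link_cover c x.
have ex : exists l, `[< meets A c l >] by exists l0; apply/asboolP; exists x.
have bnd l : `[< meets A c l >] -> (l <= len c)%N.
  by move=> /asboolP[y [_ /link_len/ltnW]].
have mr := ex_minnP ex; have ms := ex_maxnP ex bnd.
case: mr => r /asboolP Ar rmin; case: ms => s /asboolP As smax.
exists r, s; split; first by have [y [_ /link_len]] := As.
move=> l; split; last by move=> rls; exact: connected_meets rls Ar As.
by move=> Al; rewrite rmin ?smax//; exact/asboolP.
Qed.

(** A separation of the complement of all links outside the run could be completed by [G1] and [G2]
    to a separation of [X]; so [cut_wire] yields a continuum in that complement reaching from one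
    side to the other. Adding the marked points to the targets keeps both sides of the separation
    non-empty even when the run begins at the first link or ends at the last one. *)
Lemma follow c r s : compact [set: X] -> connected [set: X] ->
  (r <= s < len c)%N -> exists A, [/\ subcontinuum A,
    forall l, (r <= l <= s)%N -> meets A c l &
    forall x, A x -> exists2 l, (r <= l <= s)%N & link c l x].
Proof.
move=> cX ctX /andP[]; rewrite leq_eqVlt => /orP[/eqP <- rc|rs sc].
  exists [set pt c r]; split.
  - split; [by exists (pt c r)|exact: compact_set1|exact: connected1].
  - move=> l rl; have -> : l = r by lia.
    by exists (pt c r); split => //; exact: link_pt.
  - by move=> x ->; exists r; [lia|exact: link_pt].
pose G1 := \bigcup_(l in [set l | (l < r)%N]) link c l.
pose G2 := \bigcup_(l in [set l | (s < l)%N]) link c l.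
have oG1 : open G1 by apply: bigcup_open => l _; exact: link_open.
have oG2 : open G2 by apply: bigcup_open => l _; exact: link_open.
have G12 : G1 `&` G2 = set0.
  apply/seteqP; split=> // z [[a /= aj az] [b /= jb bz]].
  by have := link_adj bz az; lia.
have rc : (r < len c)%N by lia.
have cF : compact (~` (G1 `|` G2)).
  by apply: (subclosed_compact _ cX) => //; apply: open_closedC; exact: openU.
have cset1 x : closed [set x : X].
  by apply: compact_closed; [exact: metric_hausdorff|exact: compact_set1].
have nsep P Q : open P -> open Q -> P `&` Q = set0 ->
    ~` (G1 `|` G2) `<=` P `|` Q -> Q `&` (closure G1 `|` [set pt c r]) = set0 ->
    P `&` (closure G2 `|` [set pt c s]) = set0 -> False.
  move=> goP goQ PQ FPQ QB1 PB2.
  have GP : [set: X] `<=` (G1 `|` P) `|` (G2 `|` Q).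
    move=> z _; have [[]|/FPQ[]] := pselect ((G1 `|` G2) z).
    - by left; left.
    - by right; left.
    - by left; right.
    - by right; right.
  have dPQ : (G1 `|` P) `&` (G2 `|` Q) = set0.
    apply/seteqP; split=> // z [[a|a] [b|b]].
    - exact: disjoint_sets G12 a b.
    - by apply: disjoint_sets QB1 b _; left; exact: subset_closure.
    - by apply: disjoint_sets PB2 a _; left; exact: subset_closure.
    - exact: disjoint_sets PQ a b.
  have [h|h] := connected_open_cover ctX (openU oG1 goP) (openU oG2 goQ) dPQ GP.
    have [[l /= lr ls]|Ps] := h (pt c s) I.
      by have := link_adj (link_pt sc) ls; lia.
    by apply: disjoint_sets PB2 Ps _; right.
  have [[l /= lr ls]|Ps] := h (pt c r) I.
    by have := link_adj ls (link_pt rc); lia.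
  by apply: disjoint_sets QB1 Ps _; right.
have [A AF [Asub [[x [Ax B1x]] [y [Ay B2y]]]]] := cut_wire cF
  (closedU (closed_closure (A := G1)) (cset1 (pt c r)))
  (closedU (closed_closure (A := G2)) (cset1 (pt c s))) nsep.
have Arange z l : A z -> link c l z -> (r <= l <= s)%N.
  move=> /AF nG lz; apply/andP; split; rewrite leqNgt; apply/negP => h; apply: nG.
    by left; exists l.
  by right; exists l.
(* A point of [A] in the closure of [G1] lies in a link [l] of the run that meets a link below [r];
   adjacency leaves only [l = r]. *)
have Ar : meets A c r.
  case: B1x => [clx|xE]; last by exists x; split => //; rewrite xE; exact: link_pt.
  have [l lx] := link_cover c x; have rls := Arange _ _ Ax lx.
  have [z [[k /= kr kz] lz]] := clx _ (open_nbhs_nbhs (conj (@link_open c l) lx)).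
  have := link_adj lz kz => lk.
  by exists x; split => //; rewrite (_ : r = l)//; lia.
have As : meets A c s.
  case: B2y => [cly|yE]; last by exists y; split => //; rewrite yE; exact: link_pt.
  have [l ly] := link_cover c y; have rls := Arange _ _ Ay ly.
  have [z [[k /= kr kz] lz]] := cly _ (open_nbhs_nbhs (conj (@link_open c l) ly)).
  have := link_adj kz lz => lk.
  by exists y; split => //; rewrite (_ : s = l)//; lia.
exists A; split => //.
  move=> l rls; have [_ _ cA] := Asub; exact: connected_meets rls Ar As.
move=> z Az; have [l lz] := link_cover c z.
by exists l => //; exact: Arange Az lz.
Qed.

End chains.

(** * A walk along two chains and the growth of its segments *)

Section window.
Context (R : realType) (X : metricType R) (e : R) (c d : pchain X) (q : nat).
Hypotheses (e0 : 0 < e) (ce : mesh_lt c e) (de : mesh_lt d e) (qd : (q < len d)%N).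
Hypothesis dqc : link d q `<=` link c 0.
Hypotheses (cX : compact [set: X]) (ctX : connected [set: X]).

Let m := len c.
Let m' := len d.
Let a := (m' - q)%N.

(* The walk runs down the whole of [c], continues from link [q] of [d] up to the
   last link of [d], and then down the whole of [d]. *)
Definition walk t : X :=
  if (t < m)%N then pt c (m.-1 - t)
  else if (t < m + a)%N then pt d (q + (t - m)) else pt d (m + a + m' - t.+1).

Definition walk_link t : set X :=
  if (t < m)%N then link c (m.-1 - t)
  else if (t < m + a)%N then link d (q + (t - m)) else link d (m + a + m' - t.+1).

Definition walk_len := (m + a + m')%N.

Let m0 : (0 < m)%N := len_gt0 c.
Let m'0 : (0 < m')%N := len_gt0 d.

Let qm' : (q < m')%N := qd.

Let linkB t : (t < m)%N -> walk_link t = link c (m.-1 - t).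
Proof. by rewrite /walk_link => ->. Qed.

Let linkU t : (m <= t < m + a)%N -> walk_link t = link d (q + (t - m)).
Proof. by rewrite /walk_link => /andP[mt ->]; rewrite ltnNge mt. Qed.

Let linkD t : (m + a <= t)%N -> walk_link t = link d (m + a + m' - t.+1).
Proof.
move=> mt; rewrite /walk_link ltnNge (leq_trans (leq_addr _ _) mt)/=.
by rewrite ltnNge mt.
Qed.

Lemma walk_linkP t : (t < walk_len)%N -> walk_link t (walk t).
Proof.
rewrite /walk_len /walk_link /walk => tN; case: ifPn => tm.
  by apply: link_pt; rewrite -/m; lia.
by case: ifPn => ta; apply: link_pt; rewrite -/m' /a in ta *; lia.
Qed.

Lemma walk_mesh t x y : walk_link t x -> walk_link t y -> mdist x y < e.
Proof. by rewrite /walk_link; do 2?[case: ifPn => _]; [exact: ce|exact: de|exact: de]. Qed.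

(** Consecutive links share a point: neighbours in one chain do, link [q] of [d] lies in the first
    link of [c], and at the upper turn the last link of [d] is visited twice in a row. *)
Lemma walk_step t : (t.+1 < walk_len)%N -> mdist (walk t) (walk t.+1) < 2 * e.
Proof.
move=> tN; have h1 := walk_linkP (ltnW tN); have h2 := walk_linkP tN.
suff [x x1 x2] : exists2 x, walk_link t x & walk_link t.+1 x.
  rewrite (le_lt_trans (metric_triangle _ x _))// mulrDl mul1r.
  by rewrite ltrD//; [exact: walk_mesh h1 x1|exact: walk_mesh x2 h2].
move: tN; rewrite /walk_len => tN.
have [tm|tm] := ltnP t.+1 m.
  have [|x [x1 x2]] := @link_next _ _ c (m.-1 - t.+1); first by rewrite -/m; lia.
  exists x; last by rewrite linkB.
  by rewrite linkB; [rewrite (_ : (m.-1 - t)%N = (m.-1 - t.+1).+1)//; lia|lia].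
have [tm2|tm2] := ltnP t m.
  exists (walk t.+1) => //; rewrite linkB//; have -> : (m.-1 - t = 0)%N by lia.
  apply: dqc; move: h2; rewrite linkU; last by rewrite /a; lia.
  by rewrite (_ : q + (t.+1 - m) = q)%N//; lia.
have [ta|ta] := ltnP t.+1 (m + a).
  have [|x [x1 x2]] := @link_next _ _ d (q + (t - m)); first by rewrite -/m' /a in ta *; lia.
  exists x; first by rewrite linkU//; lia.
  by rewrite linkU; [rewrite (_ : (q + (t.+1 - m))%N = (q + (t - m)).+1)//; lia|lia].
have [ta2|ta2] := ltnP t (m + a).
  exists (walk t.+1) => //; move: h2; rewrite linkD// linkU; last by lia.
  by rewrite (_ : q + (t - m) = m + a + m' - t.+2)%N// /a; lia.
have [|x [x1 x2]] := @link_next _ _ d (m + a + m' - t.+2); first by rewrite -/m'; lia.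
exists x; last by rewrite linkD//; lia.
by rewrite linkD; [rewrite (_ : (m + a + m' - t.+1)%N = (m + a + m' - t.+2).+1)//; lia|lia].
Qed.

(** Weaker than meeting the link: a continuum that follows [c] may miss links of [d] while staying
    close to them. *)
Let nearby (A : set X) t := exists y z, [/\ walk_link t y, A z & mdist y z < e].

Let meets_nearby A t : walk_link t `&` A !=set0 -> nearby A t.
Proof. by move=> [z [z1 z2]]; exists z, z; rewrite mdistxx. Qed.

Let covers (A : set X) i j := forall x, A x -> exists2 t, (i <= t <= j)%N & walk_link t x.

Let segment i j := walk @` [set t | (i <= t <= j)%N].

(** One [e] is spent inside the link, from the point of the walk to [y], the other between [y] and
    [A]. *)
Let hclose_segment A i j : (j < walk_len)%N -> covers A i j ->
  (forall t, (i <= t <= j)%N -> nearby A t) -> hclose (2 * e) A (segment i j).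
Proof.
move=> jN cov nr; split.
  move=> x Ax; have [t tij tx] := cov _ Ax; exists (walk t); first by exists t.
  rewrite (lt_trans (walk_mesh tx (walk_linkP _)))//; first by lia.
  by rewrite mulrDl mul1r ltrDl.
move=> _ [t /= tij <-]; have [y [z [ty Az yz]]] := nr _ tij; exists z => //.
rewrite metric_sym (le_lt_trans (metric_triangle _ y _))// mulrDl mul1r ltrD//.
by apply: walk_mesh (walk_linkP _) ty; lia.
Qed.

Let coversB A i1 i j : (m.-1 - i <= i1)%N -> (m.-1 <= j)%N ->
  (forall l, meets A c l -> (l <= i1)%N) -> (i1 < m)%N -> (i <= m.-1 - i1)%N -> covers A i j.
Proof.
move=> h1 h2 h3 h4 h5 x Ax; have [l lx] := link_cover c x.
have li : (l <= i1)%N by apply: h3; exists x.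
exists (m.-1 - l)%N; first by lia.
rewrite linkB; last by lia.
by rewrite (_ : (m.-1 - (m.-1 - l))%N = l)//; lia.
Qed.

Definition growth_shadowed i j := exists A, [/\ subcontinuum A,
  hclose (2 * e) A (segment i j) &
  forall A', subcontinuum A' -> A `<=` A' -> exists i' j',
    [/\ (i' <= i)%N, (j <= j' < walk_len)%N & hclose (2 * e) A' (segment i' j')]].

(** The links met by a growth form a run of indices, and the same monotone traversal of the chain
    passes through exactly this run. The final descent of [d] is treated alike. *)
Let shadowB i j : (i <= j < m)%N -> growth_shadowed i j.
Proof.
move=> ij; have [|A [sA Am Ac]] := @follow _ _ c (m.-1 - j) (m.-1 - i) cX ctX.
  by rewrite -/m; lia.
exists A; split=> //.
  apply: hclose_segment; first by rewrite /walk_len; lia.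
    move=> x /Ac[l lij lx]; exists (m.-1 - l)%N; first lia.
    by rewrite linkB; [rewrite (_ : (m.-1 - (m.-1 - l))%N = l)//; lia|lia].
  move=> t tij; apply: meets_nearby; rewrite setIC linkB; last lia.
  by apply: Am; lia.
move=> A' [A'0 _ ctA'] AA'; have [r [s [sm rs]]] := connected_span c ctA' A'0.
have /rs hr := meetsS AA' (Am (m.-1 - j)%N ltac:(lia)).
have /rs hs := meetsS AA' (Am (m.-1 - i)%N ltac:(lia)).
rewrite -/m in sm.
exists (m.-1 - s)%N, (m.-1 - r)%N; split; [lia|rewrite /walk_len; lia|].
apply: hclose_segment; first by rewrite /walk_len; lia.
  move=> x A'x; have [l lx] := link_cover c x.
  have /rs rls : meets A' c l by exists x.
  exists (m.-1 - l)%N; first lia.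
  by rewrite linkB; [rewrite (_ : (m.-1 - (m.-1 - l))%N = l)//; lia|lia].
move=> t tij; apply: meets_nearby; rewrite setIC linkB; last lia.
by apply/rs; lia.
Qed.

Let shadowD i j : (m + a <= i <= j)%N -> (j < walk_len)%N -> growth_shadowed i j.
Proof.
rewrite /walk_len => ij jN.
have [|A [sA Am Ac]] := @follow _ _ d (walk_len - j.+1) (walk_len - i.+1) cX ctX.
  by rewrite /walk_len -/m'; lia.
rewrite /walk_len in Am Ac.
exists A; split=> //.
  apply: hclose_segment; first by rewrite /walk_len; lia.
    move=> x /Ac[l lij lx]; exists (m + a + m' - l.+1)%N; first lia.
    by rewrite linkD; [rewrite (_ : (_ - _)%N = l)//; lia|lia].
  move=> t tij; apply: meets_nearby; rewrite setIC linkD; last lia.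
  by apply: Am; lia.
move=> A' [A'0 _ ctA'] AA'; have [r [s [sm rs]]] := connected_span d ctA' A'0.
have /rs hr := meetsS AA' (Am (m + a + m' - j.+1)%N ltac:(lia)).
have /rs hs := meetsS AA' (Am (m + a + m' - i.+1)%N ltac:(lia)).
rewrite -/m' in sm.
exists (m + a + m' - s.+1)%N, (m + a + m' - r.+1)%N; split; [lia|rewrite /walk_len; lia|].
apply: hclose_segment; first by rewrite /walk_len; lia.
  move=> x A'x; have [l lx] := link_cover d x.
  have /rs rls : meets A' d l by exists x.
  exists (m + a + m' - l.+1)%N; first lia.
  by rewrite linkD; [rewrite (_ : (_ - _)%N = l)//; lia|lia].
move=> t tij; apply: meets_nearby; rewrite setIC linkD; last lia.
by apply/rs; lia.
Qed.

(** The segment contains the turn at the last link of [d], so the links met by a growth form a run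
    that ends there. The descent alone covers this run, and prolonging the segment forward is
    enough. *)
Let shadowUD i j : (m <= i < m + a)%N -> (m + a <= j < walk_len)%N -> growth_shadowed i j.
Proof.
rewrite /walk_len => ia jN; pose r := minn (q + (i - m)) (m + a + m' - j.+1).
have rE : r = minn (q + (i - m)) (m + a + m' - j.+1) by [].
have aE : a = (m' - q)%N by [].
have [|A [sA Am Ac]] := @follow _ _ d r m'.-1 cX ctX; first by rewrite -/m'; lia.
exists A; split=> //.
  apply: hclose_segment; first by rewrite /walk_len; lia.
    move=> x /Ac[l lij lx]; have [lj|lj] := leqP (m + a + m' - j.+1) l.
      exists (m + a + m' - l.+1)%N; first lia.
      by rewrite linkD; [rewrite (_ : (_ - _)%N = l)//; lia|lia].
    exists (m + (l - q))%N; first lia.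
    by rewrite linkU; [rewrite (_ : (q + _)%N = l)//; lia|lia].
  move=> t tij; apply: meets_nearby; rewrite setIC.
  have [ta|ta] := ltnP t (m + a); first by rewrite linkU; [apply: Am; lia|lia].
  by rewrite linkD; [apply: Am; lia|lia].
move=> A' [A'0 _ ctA'] AA'; have [r' [s [sm rs]]] := connected_span d ctA' A'0.
have /rs hr := meetsS AA' (Am r ltac:(lia)).
have /rs hs := meetsS AA' (Am m'.-1 ltac:(lia)).
rewrite -/m' in sm.
exists i, (m + a + m' - r'.+1)%N; split; [lia|rewrite /walk_len; lia|].
apply: hclose_segment; first by rewrite /walk_len; lia.
  move=> x A'x; have [l lx] := link_cover d x.
  have /rs rls : meets A' d l by exists x.
  exists (m + a + m' - l.+1)%N; first lia.
  by rewrite linkD; [rewrite (_ : (_ - _)%N = l)//; lia|lia].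
move=> t tij; apply: meets_nearby; rewrite setIC.
have [ta|ta] := ltnP t (m + a); first by rewrite linkU; [apply/rs; lia|lia].
by rewrite linkD; [apply/rs; lia|lia].
Qed.

Let meets_q A : meets A d q -> meets A c 0.
Proof. by move=> [x [Ax qx]]; exists x; split => //; exact: dqc. Qed.

(** A growth that stays at or above link [q] is followed along the ascent. One that goes below [q]
    meets the first link of [c]; the descent of [c] from its highest link met, [i1], then covers all
    of it, and the end [j] can stay. *)
Let shadowU i j : (m <= i <= j)%N -> (j < m + a)%N -> growth_shadowed i j.
Proof.
move=> ij ja; have aE : a = (m' - q)%N by [].
have [|A [sA Am Ac]] := @follow _ _ d (q + (i - m)) (q + (j - m)) cX ctX.
  by rewrite -/m'; lia.
exists A; split=> //.
  apply: hclose_segment; first by rewrite /walk_len; lia.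
    move=> x /Ac[l lij lx]; exists (m + (l - q))%N; first lia.
    by rewrite linkU; [rewrite (_ : (q + _)%N = l)//; lia|lia].
  by move=> t tij; apply: meets_nearby; rewrite setIC linkU; [apply: Am; lia|lia].
move=> A' [A'0 _ ctA'] AA'; have [r [s [sm rs]]] := connected_span d ctA' A'0.
have /rs hr := meetsS AA' (Am (q + (i - m))%N ltac:(lia)).
have /rs hs := meetsS AA' (Am (q + (j - m))%N ltac:(lia)).
rewrite -/m' in sm.
have [qr|rq] := leqP q r.
  exists (m + (r - q))%N, (m + (s - q))%N; split; [lia|rewrite /walk_len; lia|].
  apply: hclose_segment; first by rewrite /walk_len; lia.
    move=> x A'x; have [l lx] := link_cover d x.
    have /rs rls : meets A' d l by exists x.
    exists (m + (l - q))%N; first lia.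
    by rewrite linkU; [rewrite (_ : (q + _)%N = l)//; lia|lia].
  by move=> t tij; apply: meets_nearby; rewrite setIC linkU; [apply/rs; lia|lia].
have A'q : meets A' d q by apply/rs; lia.
have [r1 [i1 [i1m ri1]]] := connected_span c ctA' A'0.
have /ri1 h0 := meets_q A'q; rewrite -/m in i1m.
exists (m.-1 - i1)%N, j; split; [lia|rewrite /walk_len; lia|].
apply: hclose_segment; first by rewrite /walk_len; lia.
  by apply: (@coversB _ i1); try lia; move=> l /ri1; lia.
move=> t tij; apply: meets_nearby; rewrite setIC.
have [tm|tm] := ltnP t m; first by rewrite linkB; [apply/ri1; lia|lia].
by rewrite linkU; [apply/rs; lia|lia].
Qed.

(* When the segment contains the passage from [c] to [d], it is followed by
   whichever of the continua traced along its two halves covers more links of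
   [c]; growing it amounts to prolonging the segment backwards along [c] only. *)
Let shadowBD i j : (i < m <= j)%N -> (j < walk_len)%N -> growth_shadowed i j.
Proof.
rewrite /walk_len => imj jN; have aE : a = (m' - q)%N by [].
have [r [s [qrs sm' rsl lrs]]] : exists r s, [/\ (r <= q <= s)%N, (s < m')%N,
    (forall t, (m <= t <= j)%N -> exists2 l, (r <= l <= s)%N & walk_link t = link d l) &
    (forall l, (r <= l <= s)%N -> exists2 t, (m <= t <= j)%N & walk_link t = link d l)].
  have [ja|ja] := ltnP j (m + a).
    exists q, (q + (j - m))%N; split; [lia|lia| |].
      by move=> t tj; exists (q + (t - m))%N; [lia|rewrite linkU//; lia].
    move=> l lj; exists (m + (l - q))%N; first lia.
    by rewrite linkU; [rewrite (_ : (q + _)%N = l)//; lia|lia].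
  exists (minn q (m + a + m' - j.+1)), m'.-1; split; [lia|lia| |].
    move=> t tj; have [ta|ta] := ltnP t (m + a).
      by exists (q + (t - m))%N; [lia|rewrite linkU//; lia].
    by exists (m + a + m' - t.+1)%N; [lia|rewrite linkD].
  move=> l lr; have [lj|lj] := leqP (m + a + m' - j.+1) l.
    exists (m + a + m' - l.+1)%N; first lia.
    by rewrite linkD; [rewrite (_ : (_ - _)%N = l)//; lia|lia].
  exists (m + (l - q))%N; first lia.
  by rewrite linkU; [rewrite (_ : (q + _)%N = l)//; lia|lia].
have [|V [sV Vm Vc]] := @follow _ _ d r s cX ctX; first by rewrite -/m'; lia.
have [V0 _ ctV] := sV; have [r0 [i0 [i0m ri0]]] := connected_span c ctV V0.
have /ri0 h0 := meets_q (Vm q qrs); rewrite -/m in i0m.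
have [le_i0|lt_i0] := leqP (m.-1 - i) i0.
  exists V; split=> //.
    apply: hclose_segment; first by rewrite /walk_len; lia.
      move=> x /Vc[l lij lx]; have [t tj tE] := lrs _ lij.
      by exists t; [lia|rewrite tE].
    move=> t tij; apply: meets_nearby; rewrite setIC.
    have [tm|tm] := ltnP t m; first by rewrite linkB; [apply/ri0; lia|lia].
    have [|l lij ->] := rsl t; [lia|exact: Vm].
  move=> A' [A'0 _ ctA'] AA'; have [r1 [i1 [i1m ri1]]] := connected_span c ctA' A'0.
  have /ri1 h1 := meets_q (meetsS AA' (Vm q qrs)).
  have /ri1 h2 : meets A' c i0 by apply: meetsS AA' _; apply/ri0; lia.
  rewrite -/m in i1m.
  exists (m.-1 - i1)%N, j; split; [lia|rewrite /walk_len; lia|].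
  apply: hclose_segment; first by rewrite /walk_len; lia.
    by apply: (@coversB _ i1); try lia; move=> l /ri1; lia.
  move=> t tij; apply: meets_nearby; rewrite setIC.
  have [tm|tm] := ltnP t m; first by rewrite linkB; [apply/ri1; lia|lia].
  have [|l lij ->] := rsl t; [lia|exact/(meetsS AA')/Vm].
have [|A [sA Am Ac]] := @follow _ _ c 0 (m.-1 - i) cX ctX; first by rewrite -/m; lia.
(* A link of [d] in the run contains a point [y] of [V]. It lies in a link [k] of [c] with [k] at
   most [i0], hence in one that [A] meets, so [y] is within [e] of [A]. *)
have tail A' t : A `<=` A' -> (m <= t <= j)%N -> nearby A' t.
  move=> AA' /rsl[l /Vm[y [Vy ly]] tE]; have [k ky] := link_cover c y.
  have /ri0 ki0 : meets V c k by exists y.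
  have [|z [Az kz]] := Am k; first lia.
  by exists y, z; split; [rewrite tE|exact: AA'|exact: ce ky kz].
exists A; split=> //.
  apply: hclose_segment; first by rewrite /walk_len; lia.
    move=> x /Ac[l lij lx]; exists (m.-1 - l)%N; first lia.
    by rewrite linkB; [rewrite (_ : (m.-1 - (m.-1 - l))%N = l)//; lia|lia].
  move=> t tij; have [tm|tm] := ltnP t m; last by apply: tail => //; lia.
  by apply: meets_nearby; rewrite setIC linkB; [apply: Am; lia|lia].
move=> A' [A'0 _ ctA'] AA'; have [r1 [i1 [i1m ri1]]] := connected_span c ctA' A'0.
have /ri1 h1 := meetsS AA' (Am 0 ltac:(lia)).
have /ri1 h2 := meetsS AA' (Am (m.-1 - i)%N ltac:(lia)).
rewrite -/m in i1m.
exists (m.-1 - i1)%N, j; split; [lia|rewrite /walk_len; lia|].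
apply: hclose_segment; first by rewrite /walk_len; lia.
  by apply: (@coversB _ i1); try lia; move=> l /ri1; lia.
move=> t tij; have [tm|tm] := ltnP t m; last by apply: tail => //; lia.
by apply: meets_nearby; rewrite setIC linkB; [apply/ri1; lia|lia].
Qed.

Lemma walk_shadow i j : (i <= j < walk_len)%N -> growth_shadowed i j.
Proof.
move=> /andP[ij jN]; have [jm|mj] := ltnP j m; first by apply: shadowB; rewrite ij.
have [im|mi] := ltnP i m; first by apply: shadowBD => //; rewrite im.
have [ja|aj] := ltnP j (m + a); first by apply: shadowU => //; rewrite mi.
have [ia|ai] := ltnP i (m + a); last by apply: shadowD => //; rewrite ai.
by apply: shadowUD; [rewrite mi|rewrite aj].
Qed.

End window.

(** * Positions in a concatenation of blocks *)

Section concatenation.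
Context (ell : nat -> nat).
Hypothesis ell_gt0 : forall n, (0 < ell n)%N.

Definition block_start n := (\sum_(i < n) ell i)%N.

Lemma block_startS n : block_start n.+1 = (block_start n + ell n)%N.
Proof. by rewrite /block_start big_ord_recr. Qed.

Lemma block_start_ge n : (n <= block_start n)%N.
Proof. by elim: n => // n IH; rewrite block_startS; have := ell_gt0 n; lia. Qed.

Lemma leq_block_start n p : (n <= p)%N -> (block_start n <= block_start p)%N.
Proof.
elim: p => [|p IH]; first by rewrite leqn0 => /eqP->.
by rewrite leq_eqVlt => /orP[/eqP->//|/IH]; rewrite block_startS; lia.
Qed.

Fixpoint block_pos k : nat * nat :=
  if k is k'.+1 then
    let: (n, i) := block_pos k' in
    if (i.+1 < ell n)%N then (n, i.+1) else (n.+1, 0%N)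
  else (0%N, 0%N).

Lemma block_posP k : let: (n, i) := block_pos k in
  (i < ell n)%N /\ k = (block_start n + i)%N.
Proof.
elim: k => [|k] /=; first by rewrite /block_start big_ord0.
case: (block_pos k) => n i [iL kE]; case: ifPn => [h|h] /=; first by lia.
by split => //; rewrite block_startS; lia.
Qed.

Lemma block_pos_le n i k : (i < ell n)%N -> (k <= block_start n + i)%N ->
  ((block_pos k).1 <= n)%N.
Proof.
have := block_posP k; case: (block_pos k) => p j [jp kE] im /= h; rewrite leqNgt.
by apply/negP => /leq_block_start; rewrite block_startS; lia.
Qed.

Lemma block_posE n i : (i < ell n)%N -> block_pos (block_start n + i) = (n, i).
Proof.
move=> im; have := block_pos_le im (leqnn _); have := block_posP (block_start n + i).
case: block_pos => p j [jp kE] /= pn.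
have np : p = n.
  apply/eqP; rewrite eqn_leq pn leqNgt; apply/negP => /leq_block_start.
  by rewrite block_startS; lia.
by rewrite np in kE *; congr pair; lia.
Qed.

Lemma block_pos_ge n k : (block_start n <= k)%N -> (n <= (block_pos k).1)%N.
Proof.
have := block_posP k; case: (block_pos k) => p j [jp kE] h /=; rewrite leqNgt.
by apply/negP => /leq_block_start; rewrite block_startS; lia.
Qed.

Lemma block_pos_mono k l : (k <= l)%N -> ((block_pos k).1 <= (block_pos l).1)%N.
Proof.
move=> kl; have := block_posP l; case: (block_pos l) => n i [il lE] /=.
by apply: (block_pos_le il); rewrite -lE.
Qed.

End concatenation.

(** * The sequence that follows ever finer chains *)

Section shadowed_sequence.
Context (R : realType) (X : metricType R).

(* A sequence all of whose long segments are Hausdorff close to subcontinua of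
   [X], in such a way that each growth of the subcontinuum is close to some
   prolongation of the segment. *)
Record shadowed_sequence (x : nat -> X) (w : nat -> R) : Prop := {
  shadow_cvg : forall e, 0 < e -> exists n, forall k, (n <= k)%N -> w k < e;
  shadow_mono : forall k l, (k <= l)%N -> w l <= w k;
  shadow_inv : forall k, k.+1%:R^-1 <= w k;
  shadow_step : forall k, mdist (x k) (x k.+1) < w k;
  shadow_dense : forall k z, exists2 l, (k <= l)%N & mdist (x l) z < w k;
  shadow_growth : forall k l, (k <= l)%N -> exists A, [/\ subcontinuum A,
    hclose (w k) A (x @` [set t | (k <= t <= l)%N]) &
    forall A', subcontinuum A' -> A `<=` A' -> exists k' l',
      [/\ (k' <= k)%N, (l <= l')%N, w k' <= w k &
          hclose (w k) A' (x @` [set t | (k' <= t <= l')%N])]] }.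

(** Block [n] descends [c n] and climbs [c n.+1]; its window also takes in the descent of [c n.+1]
    that opens the next block. Consecutive windows overlap in a full descent, so a segment that
    starts in block [n] either fits into window [n] or runs through that whole descent. *)
Lemma chainable_shadowed_sequence : chainable X -> exists x w, shadowed_sequence x w.
Proof.
move=> chX; have [[cX ctX [x1 [x2 _]]] _] := chX.
have C_ (d : R) : {c : pchain X | 0 < d -> mesh_lt c d}.
  apply: cid; have [d0|d0] := ltP 0 d; first by have [c] := chainable_pchain chX d0; exists c.
  by have [c] := chainable_pchain chX ltr01; exists c.
have r_ (c : pchain X) : {r : R | 0 < r & forall y, mdist (pt c 0) y < r -> link c 0 y}.
  apply: cid2; have := link_pt (len_gt0 c); have := @link_open _ _ c 0.
  rewrite openE => /[apply] /nbhs_ballP[r /= r0 h]; exists r => // y hy; apply: h.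
  by rewrite ballEmdist.
(* The mesh of each chain is below the radius of a ball about the first marked point of its
   predecessor that lies in the first link there. A link containing this point is then inside that
   first link, as the passage of the walk requires. *)
pose f := fix f n := if n is p.+1 then Num.min p.+2%:R^-1 (s2val (r_ (sval (C_ (f p))))) else 1.
pose c n := sval (C_ (f n)).
have f0 n : 0 < f n.
  by case: n => [|n] //=; rewrite lt_min invr_gt0 ltr0n/=; exact: (s2valP (r_ _)).
have fle n : f n <= n.+1%:R^-1 by case: n => [|n] /=; rewrite ?invr1// ge_min lexx.
have cf n : mesh_lt (c n) (f n) by exact: (svalP (C_ (f n))).
pose e n : R := n.+1%:R^-1.
have e_gt0 n : 0 < e n by rewrite /e invr_gt0.
have ele n p : (n <= p)%N -> e p <= e n by move=> np; rewrite /e lef_pV2 ?posrE// ler_nat.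
have ce n : mesh_lt (c n) (e n) by exact: mesh_ltW (fle n) (cf n).
have ceS n : mesh_lt (c n.+1) (e n) by exact: mesh_ltW (ele _ _ (leqnSn n)) (ce n.+1).
have q_ n : {q | link (c n.+1) q (pt (c n) 0)} by apply: cid; exact: link_cover.
pose q n := sval (q_ n); have qP n : link (c n.+1) (q n) (pt (c n) 0) := svalP (q_ n).
have ql n : (q n < len (c n.+1))%N by exact: link_len (qP n).
have qsub n : link (c n.+1) (q n) `<=` link (c n) 0.
  move=> y qy; apply: (s2valP' (r_ (c n))).
  by apply: lt_le_trans (cf _ _ _ _ (qP n) qy) _; rewrite /= ge_min lexx orbT.
pose ell n := (len (c n) + (len (c n.+1) - q n))%N.
have ell0 n : (0 < ell n)%N by rewrite /ell; have := len_gt0 (c n); lia.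
pose W n := walk (c n) (c n.+1) (q n).
pose x k := W (block_pos ell k).1 (block_pos ell k).2.
pose st k := (block_pos ell k).1.
have WE n : walk_len (c n) (c n.+1) (q n) = (ell n + len (c n.+1))%N by [].
(* The last [len (c n.+1)] places of window [n] belong to block [n.+1], where the same descent is
   computed from the other chain of the pair. *)
have xE n i : (i < ell n + len (c n.+1))%N -> x (block_start ell n + i)%N = W n i.
  move=> ilt; have [il|li] := ltnP i (ell n); first by rewrite /x block_posE.
  have -> : (block_start ell n + i = block_start ell n.+1 + (i - ell n))%N.
    by rewrite block_startS; lia.
  rewrite /x block_posE//=; last by rewrite /ell in li ilt *; lia.
  rewrite /W /walk; rewrite /ell in li ilt *; have := ql n => qn; have := len_gt0 (c n.+1) => l0.
  rewrite ifT; last by lia.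
  rewrite ifF; last by lia.
  rewrite ifF; last by lia.
  by congr (pt _ _); rewrite /ell; lia.
have stE n i : (i < ell n)%N -> st (block_start ell n + i)%N = n.
  by move=> il; rewrite /st block_posE.
pose w k : R := 4 * e (st k).
have imgE n i j : (j < ell n + len (c n.+1))%N ->
    x @` [set t | (block_start ell n + i <= t <= block_start ell n + j)%N] =
    W n @` [set t | (i <= t <= j)%N].
  move=> jl; apply/seteqP; split=> _ [t /= tij <-].
    exists (t - block_start ell n)%N => /=; first by lia.
    by rewrite -xE; [congr x; lia|lia].
  by exists (block_start ell n + t)%N; [rewrite /=; lia|rewrite xE//; lia].
have e4 n : 2 * e n <= 4 * e n by rewrite ler_pM2r// ler_nat.
have full k z : exists2 l, (block_start ell (st k).+1 <= l < block_start ell (st k).+1 + len (c (st k).+1))%N &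
    mdist (x l) z < w k.
  set n := (st k).+1; have [l lz] := link_cover (c n) z.
  have ln := link_len lz; exists (block_start ell n + ((len (c n)).-1 - l))%N; first lia.
  rewrite xE; last by rewrite /ell; lia.
  rewrite /W /walk ifT; last by lia.
  rewrite (lt_le_trans (ce n _ _ _ (link_pt _) _))//.
  - by lia.
  - by rewrite (_ : (_ - _)%N = l)//; lia.
  - rewrite /w (le_trans (ele _ _ (leqnSn _)))// ler_peMl// ?ler1n//.
    exact: ltW.
exists x, w; split.
- move=> d d0; have [n nd] : exists n, 4 * e n < d.
    have := archi_boundP (ltW (divr_gt0 (ltr0n R 4) d0)).
    set N := Num.bound _ => hN; exists N; rewrite /e ltr_pdivrMr ?ltr0n//.
    by rewrite mulrC -ltr_pdivrMr// (lt_trans hN)// ltr_nat.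
  exists (block_start ell n) => k nk; apply: le_lt_trans nd.
  by rewrite /w ler_pM2l// ele// block_pos_ge.
- by move=> k l kl; rewrite /w ler_pM2l// ele// block_pos_mono.
- move=> k; rewrite /w (@le_trans _ _ (e (st k)))//; last by rewrite ler_peMl ?ler1n// ltW.
  apply: ele; have := block_posP ell0 k; rewrite /st; case: block_pos => n i [_ kE] /=.
  by have := block_start_ge ell0 n; lia.
- move=> k; have := block_posP ell0 k; rewrite /w /st; case E: (block_pos ell k) => [n i] [il kE] /=.
  rewrite kE -addnS !xE//; try by have := len_gt0 (c n.+1); lia.
  apply: lt_le_trans (e4 n).
  apply: (walk_step (e_gt0 n) (ce n) (ceS n) (ql n) (@qsub n)).
  by rewrite WE; have := len_gt0 (c n.+1); lia.
- move=> k z; have [l hl h] := full k z; exists l => //.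
  have := block_posP ell0 k; move: hl; rewrite /st; case: (block_pos ell k) => n i /= + [il kE].
  by rewrite block_startS; lia.
- move=> k l kl; have := block_posP ell0 k; case E: (block_pos ell k) => [n i] [il kE].
  have stk : st k = n by rewrite /st E.
  have [ln|nl] := ltnP l (block_start ell n + (ell n + len (c n.+1))).
    have [|A [sA cA gA]] := walk_shadow (e_gt0 n) (ce n) (ceS n) (ql n) (@qsub n) cX ctX (i := i) (j := (l - block_start ell n)%N).
      by rewrite WE; lia.
    exists A; split=> //.
      rewrite /w stk; apply: hclose_le (e4 n) _; rewrite kE.
      rewrite (_ : l = (block_start ell n + (l - block_start ell n))%N); last by lia.
      by rewrite imgE; [|lia].
    move=> A' sA' /(gA _ sA')[i' [j' [i'i]]]; rewrite WE => jj' hA'.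
    exists (block_start ell n + i')%N, (block_start ell n + j')%N; split; [lia|lia| |].
      (* Going back from [k] to [k'] could increase [w]; here both lie in block [n], on which [w] is
         constant. *)
      by rewrite /w stE ?stk//; lia.
    rewrite /w stk; apply: hclose_le (e4 n) _.
    by rewrite imgE; [|lia].
  (* The segment includes the whole descent of [c n.+1], so it is shadowed by [X] itself, which
     cannot grow. *)
  have hX : hclose (w k) [set: X] (x @` [set t | (k <= t <= l)%N]).
    split=> [z _|_ [t _ <-]]; last by exists (x t); rewrite // mdistxx /w mulr_gt0.
    have [t tP tz] := full k z; rewrite stk block_startS in tP.
    by exists (x t); [exists t => //=; lia|rewrite metric_sym].
  exists setT; split=> //; first by split => //; exists x1.
  move=> A' _ TA'; exists k, l; split => //.
  by rewrite (_ : A' = setT)//; apply/seteqP; split.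
Qed.

End shadowed_sequence.

(** * Metrics induced by bounded families of functions *)

Section sup_metric.
Context (R : realType) (T : choiceType) (I : Type) (i0 : I) (Phi : T -> I -> R) (M : R).

(** The sup norm distance, pulled back along [Phi] from the bounded functions on [I]. *)
Definition sup_dist (s t : T) : R := sup [set `|Phi s i - Phi t i| | i in [set: I]].

Hypothesis PhiM : forall t i, `|Phi t i| <= M.
Hypothesis Phi_inj : forall s t, (forall i, Phi s i = Phi t i) -> s = t.

Lemma sup_dist_ge s t i : `|Phi s i - Phi t i| <= sup_dist s t.
Proof.
apply: ub_le_sup; last by exists i.
exists (M + M) => _ [j _ <-]; rewrite (le_trans (ler_normB _ _))//.
exact: lerD.
Qed.

Lemma sup_dist_le s t e : (forall i, `|Phi s i - Phi t i| <= e) -> sup_dist s t <= e.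
Proof. by move=> h; apply: ge_sup; [exists `|Phi s i0 - Phi t i0|, i0|move=> _ [i _ <-]]. Qed.

Lemma sup_distxx s : sup_dist s s = 0.
Proof.
apply/eqP; rewrite eq_le; apply/andP; split.
  by apply: sup_dist_le => i; rewrite subrr normr0.
by apply: le_trans (sup_dist_ge s s i0).
Qed.

Lemma sup_dist_positivity s t : sup_dist s t = 0 -> s = t.
Proof.
move=> st; apply: Phi_inj => i; apply/eqP; rewrite -subr_eq0 -normr_le0 -st.
exact: sup_dist_ge.
Qed.

Lemma sup_dist_sym s t : sup_dist s t = sup_dist t s.
Proof. by congr sup; apply/seteqP; split=> _ [i _ <-]; exists i; rewrite // distrC. Qed.

Lemma sup_dist_triangle t s v : sup_dist s v <= sup_dist s t + sup_dist t v.
Proof.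
apply: sup_dist_le => i; rewrite -(subrKA (Phi t i)) (le_trans (ler_normD _ _))//.
by apply: lerD; exact: sup_dist_ge.
Qed.

(** A copy of [T] with the proofs recorded in its type, so that the metric structure can be attached
    to the type and inferred from it. *)
Definition sup_space of I & (forall t i, `|Phi t i| <= M) &
  (forall s t, (forall i, Phi s i = Phi t i) -> s = t) : Type := T.

HB.instance Definition _ := Choice.on (sup_space i0 PhiM Phi_inj).
HB.instance Definition _ := isMetric.Build R (sup_space i0 PhiM Phi_inj)
  sup_distxx sup_dist_positivity sup_dist_sym sup_dist_triangle.

End sup_metric.

(* [Y] is the disjoint union of the image of the isometry [i] and of the ray [g],
   parametrized by [0, +oo[; the function [tau] is the distance to the former and
   the coordinate of the latter in (0, 1]. *)
Record ray_space (R : realType) (X Y : metricType R) (x : nat -> X) (w : nat -> R)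
    (i : X -> Y) (g : R -> Y) (tau : Y -> R) (r : Y -> X) : Prop := {
  ray_iso : forall z z', mdist (i z) (i z') = mdist z z';
  ray_tau_lip : forall y y', `|tau y - tau y'| <= mdist y y';
  ray_tau_i : forall z, tau (i z) = 0;
  ray_tau_g : forall u, 0 <= u -> tau (g u) = (1 + u)^-1;
  ray_cases : forall y, (exists z, y = i z) \/ (exists2 u, 0 <= u & y = g u);
  ray_g_cont : continuous g;
  ray_r_i : forall z, r (i z) = z;
  ray_r_g : forall u, 0 <= u -> r (g u) = x (Num.truncn u);
  ray_near : forall u, 0 <= u -> mdist (g u) (i (x (Num.truncn u))) <= w (Num.truncn u) }.

(** * Construction of the ray next to [X] *)

Section ray_space_construction.
Context (R : realType) (X : metricType R) (x : nat -> X) (w : nat -> R) (D : R).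
Hypotheses (D0 : 0 < D) (hD : forall y z : X, mdist y z <= D).
Hypotheses (winv : forall k, k.+1%:R^-1 <= w k) (wstep : forall k, mdist (x k) (x k.+1) < w k).

Let D2 : 0 <= 2 * D. Proof. by rewrite mulr_ge0// ltW. Qed.

(** The penalty vanishes for [j] within 1/2 of [u]. Its slope [2 * D] brings it to at least [D] once
    [j] is at distance 1 or more, which makes the term non-positive. *)
Let term u y j := mdist (x j) y - 2 * D * Num.max 0 (`|u - j%:R| - 2^-1).

(* Unlike the distance functions from the points of a piecewise geodesic, which
   need not exist, these interpolate between those of the points [x j], and
   depend on [u] in a Lipschitz way. *)
Let ray_fun (u : R) (y : X) : R := sup [set term u y j | j in [set: nat]].

Let term_le u y j : term u y j <= mdist (x j) y.
Proof.
by rewrite /term lerBlDr lerDl mulr_ge0 ?D2// le_max lexx.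
Qed.

Let ray_fun_ge u y j : term u y j <= ray_fun u y.
Proof.
apply: ub_le_sup; last by exists j.
by exists D => _ [k _ <-]; apply: le_trans (term_le _ _ _) (hD _ _).
Qed.

Let ray_fun_le u y a : (forall j, term u y j <= a) -> ray_fun u y <= a.
Proof. by move=> h; apply: ge_sup; [exists (term u y 0), 0%N|move=> _ [j _ <-]]. Qed.

Let ray_fun_leD u v y : ray_fun u y <= ray_fun v y + 2 * D * `|u - v|.
Proof.
apply: ray_fun_le => j; apply: le_trans (lerD (ray_fun_ge v y j) (lexx _)).
rewrite /term -addrA lerD2l -subr_ge0 opprK.
have -> : - (2 * D * Num.max 0 (`|v - j%:R| - 2^-1)) + 2 * D * `|u - v| +
  2 * D * Num.max 0 (`|u - j%:R| - 2^-1) =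
  2 * D * (Num.max 0 (`|u - j%:R| - 2^-1) + `|u - v| - Num.max 0 (`|v - j%:R| - 2^-1)) by ring.
rewrite mulr_ge0 ?D2//.
rewrite subr_ge0 ge_max; apply/andP; split.
  by rewrite addr_ge0// le_max lexx.
have := ler_distD u v j%:R; rewrite (distrC v u) => h.
apply: (@le_trans _ _ ((`|u - j%:R| - 2^-1) + `|u - v|)); first by lra.
by rewrite lerD2r le_max lexx orbT.
Qed.

Let ray_fun_lip u v y : `|ray_fun u y - ray_fun v y| <= 2 * D * `|u - v|.
Proof.
have := ray_fun_leD u v y; have := ray_fun_leD v u y; rewrite (distrC v) => h1 h2.
by rewrite ler_norml; apply/andP; split; lra.
Qed.

Let ray_fun_ge_nearest u y : 0 <= u ->
  let k := Num.truncn u in mdist (x k) y <= ray_fun u y \/ mdist (x k.+1) y <= ray_fun u y.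
Proof.
move=> u0 k; have /andP[ku uk] := truncn_itv u0.
rewrite -/k -natr1 in ku uk.
have [h|h] := lerP (u - k%:R) 2^-1; [left|right].
  apply: le_trans (ray_fun_ge u y k).
  by rewrite /term max_l ?mulr0 ?subr0// ger0_norm; lra.
apply: le_trans (ray_fun_ge u y k.+1).
by rewrite /term max_l ?mulr0 ?subr0// -natr1 ler0_norm; lra.
Qed.

(** One of the indices [k] and [k.+1] is within 1/2 of [u] and carries no penalty, which gives the
    lower bound; every other index is at least 1 away from [u] and contributes nothing positive. *)
Let ray_fun_near u y : 0 <= u ->
  `|ray_fun u y - mdist (x (Num.truncn u)) y| <= w (Num.truncn u).
Proof.
move=> u0; set k := Num.truncn u; have /andP[ku uk] := truncn_itv u0.
rewrite -/k in ku uk.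
have step z : `|mdist (x k.+1) z - mdist (x k) z| <= w k.
  by rewrite distrC; apply: le_trans (mdist_lipschitz _ _ _) (ltW (wstep k)).
have := step y; rewrite !ler_norml => /andP[s1 s2].
have wk0 : 0 <= w k by rewrite (le_trans _ (winv k))// invr_ge0.
have uk' : u < k%:R + 1 by rewrite -natr1 in uk.
apply/andP; split.
  by have [|] := ray_fun_ge_nearest y u0; rewrite -/k; lra.
rewrite lerBlDr; apply: ray_fun_le => j.
have [->|jk] := eqVneq j k; first by rewrite (le_trans (term_le _ _ _))// lerDr.
have [->|jk1] := eqVneq j k.+1; first by rewrite (le_trans (term_le _ _ _))//; lra.
have uj : 1 <= `|u - j%:R|.
  have [jlt|jgt] : (j.+1 <= k)%N \/ (k.+2 <= j)%N by lia.
    rewrite ger0_norm; have : j.+1%:R <= k%:R :> R by rewrite ler_nat.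
      by rewrite -natr1; lra.
    by rewrite -natr1; lra.
  have : k.+2%:R <= j%:R :> R by rewrite ler_nat.
  by rewrite -natr1 -natr1 => h; rewrite ler0_norm; lra.
rewrite /term (@le_trans _ _ 0)//; last by rewrite addr_ge0// mdist_ge0.
rewrite subr_le0 (le_trans (hD _ _))// mulrAC ler_peMl//; first exact: ltW.
by rewrite mulrC -ler_pdivrMr// mul1r le_max; apply/orP; right; lra.
Qed.

Let ray_fun_bound u y : 0 <= u -> `|ray_fun u y| <= D.
Proof.
move=> u0; rewrite ger0_norm.
  by apply: ray_fun_le => j; exact: le_trans (term_le _ _ _) (hD _ _).
by have [] := ray_fun_ge_nearest y u0; apply: le_trans; exact: mdist_ge0.
Qed.

Let carrier := (X + {u : R | 0 <= u})%type.

(** The Kuratowski embedding of [X], extended to the ray. The extra coordinate [None] becomes [tau]: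
    it vanishes on [X], so it leaves the metric there unchanged, and it keeps the points of the ray
    apart from [X] and from each other. *)
Let coord (s : carrier) (o : option X) : R := match s, o with
  | inl z, Some y => mdist z y
  | inl _, None => 0
  | inr u, Some y => ray_fun (val u) y
  | inr u, None => (1 + val u)^-1
  end.

Let inv1D_gt0 (u : R) : 0 <= u -> 0 < (1 + u)^-1.
Proof. by move=> u0; rewrite invr_gt0 ltr_pwDl. Qed.

Let inv1D_le1 (u : R) : 0 <= u -> (1 + u)^-1 <= 1.
Proof. by move=> u0; rewrite invf_le1 ?lerDl// ltr_pwDl. Qed.

Let coord_bound s o : `|coord s o| <= 1 + D.
Proof.
case: s o => [z|[u u0]] [y|] /=.
- by rewrite ger0_norm ?mdist_ge0// (le_trans (hD _ _))// lerDr.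
- by rewrite normr0 addr_ge0// ltW.
- by rewrite (le_trans (ray_fun_bound _ _))// lerDr.
- rewrite ger0_norm; last by rewrite ltW// inv1D_gt0.
  by rewrite (@le_trans _ _ 1) ?inv1D_le1// lerDl ltW.
Qed.

Let coord_inj s t : (forall o, coord s o = coord t o) -> s = t.
Proof.
case: s t => [z|[u u0]] [z'|[v v0]] h.
- have := h (Some z'); rewrite /= mdistxx => /mdist_positivity ->//.
- by have := h None => /= h'; have := inv1D_gt0 v0; rewrite -h' ltxx.
- by have := h None => /= h'; have := inv1D_gt0 u0; rewrite h' ltxx.
- have := h None => /= /invr_inj/addrI uv; congr inr; exact/val_inj.
Qed.

Let Y : metricType R := sup_space None coord_bound coord_inj.

Lemma ray_space_exists : exists (Y : metricType R) i g tau r,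
  @ray_space R X Y x w i g tau r.
Proof.
have p_ge0 (u : R) : 0 <= Num.max 0 u by rewrite le_max lexx.
(* Sending negative parameters to 0 makes [g] a Lipschitz map on the whole line. *)
pose p (u : R) : {u : R | 0 <= u} := exist _ (Num.max 0 u) (p_ge0 u).
have pE u : 0 <= u -> val (p u) = u by move=> u0; rewrite /= max_r.
pose i (z : X) : Y := inl z.
pose g (u : R) : Y := inr (p u).
pose tau (s : Y) : R := coord s None.
pose r (s : Y) : X := match s with inl z => z | inr u => x (Num.truncn (val u)) end.
have dle (s t : Y) e : (forall o, `|coord s o - coord t o| <= e) -> mdist s t <= e.
  exact: (sup_dist_le None).
have dge (s t : Y) o : `|coord s o - coord t o| <= mdist s t.
  exact: (sup_dist_ge coord_bound).
have p0 u : 0 <= val (p u) by rewrite /= le_max lexx.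
have inv_lip (u v : R) : 0 <= u -> 0 <= v -> `|(1 + u)^-1 - (1 + v)^-1| <= `|u - v|.
  move=> u0 v0; have u1 : 1 + u != 0 by rewrite gt_eqF// ltr_pwDl.
  have v1 : 1 + v != 0 by rewrite gt_eqF// ltr_pwDl.
  have -> : (1 + u)^-1 - (1 + v)^-1 = (v - u) * ((1 + u)^-1 * (1 + v)^-1).
    by field; rewrite ?u1 ?v1.
  rewrite normrM (distrC v) ler_piMr// ger0_norm; last first.
    by rewrite mulr_ge0// ltW// inv1D_gt0.
  by rewrite mulr_ile1 ?inv1D_le1// ltW// inv1D_gt0.
exists Y, i, g, tau, r; split.
- move=> z z'; apply/eqP; rewrite eq_le; apply/andP; split.
    apply: dle => -[y|] /=; first exact: mdist_lipschitz.
    by rewrite subrr normr0 mdist_ge0.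
  have := dge (i z) (i z') (Some z').
  by rewrite /= mdistxx subr0 ger0_norm// mdist_ge0.
- by move=> y y'; exact: dge.
- by [].
- by move=> u u0; rewrite /tau /g /= max_r.
- move=> [z|[u u0]]; [by left; exists z|right]; exists u => //.
  by rewrite /g; congr inr; apply/val_inj; rewrite pE.
- apply: (@lipschitz_continuous R R^o Y g (1 + 2 * D)).
    by rewrite ltr_pwDl.
  move=> u v; rewrite {2}/mdist/= distrC.
  have puv : `|val (p u) - val (p v)| <= `|u - v|.
    rewrite /= /Num.max; case: ifPn => u0; case: ifPn => v0.
    - by [].
    - rewrite -leNgt in v0; rewrite subr0 ger0_norm ?(ltW u0)//.
      by rewrite ger0_norm; lra.
    - rewrite -leNgt in u0; rewrite sub0r normrN ger0_norm ?(ltW v0)//.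
      by rewrite ler0_norm; lra.
    - by rewrite subrr normr0.
  apply: dle => -[y|].
    apply: (le_trans (ray_fun_lip _ _ _)).
    by apply: (le_trans (ler_wpM2l D2 puv)); rewrite ler_wpM2r// lerDr.
  apply: (le_trans (inv_lip _ _ (p0 u) (p0 v))).
  by apply: (le_trans puv); rewrite ler_peMl// lerDl.
- by [].
- by move=> u u0; rewrite /r /g pE.
- move=> u u0; have k0 : 0 <= w (Num.truncn u) by rewrite (le_trans _ (winv _)).
  apply: dle => -[y|]; rewrite /= max_r//; first exact: ray_fun_near.
  (* In the coordinate [None] the distance is [(1 + u)^-1]; the lower bound on [w] serves to
     dominate it. *)
  rewrite subr0 gtr0_norm ?inv1D_gt0// (le_trans _ (winv _))//.
  rewrite lef_pV2 ?posrE ?ltr0n// ?ltr_pwDl//.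
  by rewrite -natr1 addrC lerD2l truncn_le.
Qed.

End ray_space_construction.

Lemma within_lipschitz_continuous (R : realType) (U V : metricType R) (f : U -> V)
    (A : set U) (k : R) : 0 < k ->
  (forall x y, A x -> A y -> mdist (f x) (f y) <= k * mdist x y) ->
  {within A, continuous f}.
Proof.
move=> k0 fk; apply/subspace_continuousP => x Ax.
apply/metricType_numDomainType.cvgrPdist_lt => e e0.
rewrite near_withinE; near=> y => Ay.
rewrite (le_lt_trans (fk _ _ Ax Ay))// mulrC -ltr_pdivlMr//.
have : ball x (e / k) y by near: y; apply: nbhsx_ballx; exact: divr_gt0.
by rewrite ballEmdist.
Unshelve. all: by end_near. Qed.

Lemma closure_mdistP (R : realType) (T : metricType R) (A : set T) (y : T) :
  (forall e, 0 < e -> exists2 a, A a & mdist y a < e) -> closure A y.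
Proof.
move=> h V /nbhs_ballP[e /= e0 yeV]; have [a Aa ya] := h _ e0.
by exists a; split => //; apply: yeV; rewrite ballEmdist.
Qed.

(** * Compactness and subcontinua of the ray space *)

Section ray_space_theory.
Context (R : realType) (X Y : metricType R) (x : nat -> X) (w : nat -> R).
Context (i : X -> Y) (g : R -> Y) (tau : Y -> R) (r : Y -> X).
Hypotheses (rs : ray_space x w i g tau r) (sh : shadowed_sequence x w).
Hypothesis contX : continuum X.

Let w_gt0 k : 0 < w k.
Proof. by rewrite (lt_le_trans _ (shadow_inv sh k))// invr_gt0. Qed.

Let tau_ge0 y : 0 <= tau y.
Proof.
have [[z ->]|[u u0 ->]] := ray_cases rs y; first by rewrite (ray_tau_i rs).
by rewrite (ray_tau_g rs)// invr_ge0 addr_ge0.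
Qed.

Let tau_le1 y : tau y <= 1.
Proof.
have [[z ->]|[u u0 ->]] := ray_cases rs y; first by rewrite (ray_tau_i rs).
by rewrite (ray_tau_g rs)// invf_le1 ?lerDl// ltr_pwDl.
Qed.

Let tau_g_gt0 u : 0 <= u -> 0 < tau (g u).
Proof. by move=> u0; rewrite (ray_tau_g rs)// invr_gt0 ltr_pwDl. Qed.

Let tau_gt0 y : 0 < tau y -> exists2 u, 0 <= u & y = g u.
Proof.
have [[z ->]|//] := ray_cases rs y; by rewrite (ray_tau_i rs) ltxx.
Qed.

Let tau_eq0 y : tau y = 0 -> y = i (r y).
Proof.
have [[z ->]|[u u0 ->]] := ray_cases rs y; first by rewrite (ray_r_i rs).
by move=> h; have := tau_g_gt0 u0; rewrite h ltxx.
Qed.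

Let tau_inj y y' : 0 < tau y -> tau y = tau y' -> y = y'.
Proof.
move=> y0 yy'; have [u u0 yE] := tau_gt0 y0.
have [u' u'0 y'E] := tau_gt0 (eq_ind _ (fun t => 0 < t) y0 _ yy').
by move: yy'; rewrite yE y'E !(ray_tau_g rs)// => /invr_inj/addrI ->.
Qed.

Let tau_cont : continuous tau.
Proof.
apply: (@lipschitz_continuous R Y R^o tau 1 ltr01) => y y'.
by rewrite mul1r {1}/mdist/= distrC; exact: (ray_tau_lip rs).
Qed.

Let i_cont : continuous i.
Proof.
apply: (@lipschitz_continuous R X Y i 1 ltr01) => y y'.
by rewrite mul1r (ray_iso rs).
Qed.

Let r_within : {within range i, continuous r}.
Proof.
apply: (@within_lipschitz_continuous R Y X r _ 1 ltr01) => _ _ [y _ <-] [y' _ <-].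
by rewrite mul1r !(ray_r_i rs) (ray_iso rs).
Qed.

Let i_inj : injective i.
Proof. exact: can_inj (ray_r_i rs). Qed.

Let w_truncn_lt e : 0 < e -> exists2 N, (0 < N)%N & 
  forall u : R, 0 <= u -> N%:R <= u -> w (Num.truncn u) < e.
Proof.
move=> e0; have [N h] := shadow_cvg sh e0; exists N.+1 => // u u0 Nu; apply: h.
by apply: ltnW; rewrite -(natrK (R := R) N.+1); apply: (@le_truncn R).
Qed.

Let tau_small e : 0 < e -> exists2 d, 0 < d &
  forall u : R, 0 <= u -> tau (g u) < d -> w (Num.truncn u) < e.
Proof.
move=> e0; have [N N0 h] := w_truncn_lt e0; exists (1 + N%:R)^-1.
  by rewrite invr_gt0 ltr_pwDl.
move=> u u0; rewrite (ray_tau_g rs)// ltf_pV2 ?posrE; first by rewrite ltrD2l => /ltW; exact: h.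
- by rewrite ltr_pwDl.
- by rewrite ltr_pwDl.
Qed.

Let mdist_i_r e : 0 < e -> exists2 d, 0 < d &
  forall y, tau y < d -> mdist y (i (r y)) < e.
Proof.
move=> e0; have [d d0 h] := tau_small e0; exists d => // y.
have [[z ->]|[u u0 ->]] := ray_cases rs y; first by rewrite (ray_r_i rs) mdistxx.
move=> /(h _ u0); rewrite (ray_r_g rs)//; apply: le_lt_trans.
exact: (ray_near rs).
Qed.

Let seg u v := g @` `[u, v].

Let seg_compact u v : compact (seg u v).
Proof.
apply: continuous_compact; last exact: segment_compact.
exact/continuous_subspaceT/(ray_g_cont rs).
Qed.

Let seg_connected u v : connected (seg u v).
Proof.
apply: connected_continuous_connected; first exact: segment_connected.
exact/continuous_subspaceT/(ray_g_cont rs).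
Qed.

(** An ultrafilter either contains a set on which [tau] is bounded away from 0, a compact arc of the
    ray, or it contains every set where [tau] is small. In the latter case [r] moves points
    arbitrarily little, and a cluster point of the image under [r] in [X] is a limit. *)
Lemma ray_space_compact : compact [set: Y].
Proof.
rewrite compact_ultra => F UF _.
have [[d d0 Fd]|nd] := pselect (exists2 d, 0 < d & F (~` [set y | tau y < d])).
  have := @seg_compact 0 (d^-1 - 1); rewrite compact_ultra => /(_ F UF)[].
    apply: filterS Fd => y /= /negP; rewrite -leNgt => dy.
    have [u u0 yE] := tau_gt0 (lt_le_trans d0 dy); exists u => //=.
    rewrite in_itv/= u0/= lerBrDl -(invrK (1 + u)) lef_pV2 ?posrE//.
      by rewrite -(ray_tau_g rs)// -yE.
    by rewrite invr_gt0 ltr_pwDl.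
  by move=> p [_ Fp]; exists p.
have {}nd d : 0 < d -> F [set y | tau y < d].
  move=> d0; have [//|h] := in_ultra_setVsetC [set y | tau y < d] UF.
  by exfalso; apply: nd; exists d.
have [cX _ _] := contX.
have [z [_ clz]] := cX (r @ F) _ (@filterT _ F _).
exists (i z); split => //.
change (F --> i z); suff : cluster F (i z) by rewrite ultra_cvg_clusterE.
move=> A B FA /nbhs_ballP[e /= e0 hB].
have e20 : 0 < e / 2 by rewrite divr_gt0.
have [d d0 hd] := mdist_i_r e20.
have Frd : (r @ F) (r @` (A `&` [set y | tau y < d])).
  by apply: (@filterS _ F _ _ _ _ (filterI FA (nd _ d0))) => y Ay; exists y.
have [_ [[y [Ay yd] <-]]] := clz _ _ Frd (nbhsx_ballx z _ e20); rewrite ballEmdist/= => zy.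
exists y; split => //; apply: hB; rewrite ballEmdist/=.
rewrite (le_lt_trans (metric_triangle _ (i (r y)) _))// (ray_iso rs).
by rewrite (splitr e) ltrD// metric_sym hd.
Qed.

Lemma ray_dense_end v z : closure (g @` [set u | v <= u]) (i z).
Proof.
apply: closure_mdistP => e e0; have e20 : 0 < e / 2 by rewrite divr_gt0.
have [N h] := shadow_cvg sh e20.
pose k := maxn N (Num.truncn (Num.max 0 v)).+1.
have [l kl lz] := shadow_dense sh k z; exists (g l%:R).
  exists l%:R => //=; have : v <= Num.max 0 v by rewrite le_max lexx orbT.
  move=> /le_trans; apply; have /andP[_ /ltW/le_trans] : (Num.truncn (Num.max 0 v))%:R <= Num.max 0 v < (Num.truncn (Num.max 0 v)).+1%:R.
    by apply: truncn_itv; rewrite le_max lexx.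
  by apply; rewrite ler_nat /k in kl *; lia.
rewrite (le_lt_trans (metric_triangle _ (i (x l)) _))// (ray_iso rs).
rewrite (splitr e) ltrD//.
  by rewrite metric_sym (lt_trans lz)// h// /k; lia.
rewrite metric_sym; have := ray_near rs (ler0n R l); rewrite natrK => /le_lt_trans; apply.
by apply: h; rewrite /k in kl *; lia.
Qed.

Let ray := g @` [set u | 0 <= u].

Lemma ray_dense : dense ray.
Proof.
move=> O [y Oy] oO.
have [[z yz]|[u u0 yu]] := ray_cases rs y; last by exists y; split => //; exists u.
have := @ray_dense_end 0 z; rewrite -yz => /(_ O).
case; first by apply: open_nbhs_nbhs.
by move=> y' [ry' Oy']; exists y'.
Qed.
(** For [0 < a] an arc of the ray, for [a = 0] the space [X] together with a tail of the ray. All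
    subcontinua that meet the ray turn out to be of this form. *)
Definition slab a b := [set y | a <= tau y <= b].

Let slab_closed a b : closed (slab a b).
Proof.
have -> : slab a b = tau @^-1` [set` `[a, b]].
  by apply/seteqP; split=> y /=; rewrite /slab in_itv.
by have /continuous_closedP := tau_cont; apply; exact: interval_closed.
Qed.

Let slab_seg a b : 0 < a -> a <= b -> b <= 1 ->
  slab a b = seg (b^-1 - 1) (a^-1 - 1).
Proof.
move=> a0 ab b1; have b0 := lt_le_trans a0 ab.
have b1' : 1 <= b^-1 by rewrite invf_ge1.
apply/seteqP; split=> [y /= /andP[ay yb]|_ [u /= + <-]].
  have [u u0 yE] := tau_gt0 (lt_le_trans a0 ay); exists u => //=.
  move: ay yb; rewrite yE (ray_tau_g rs)// => au ub.
  have u1 : 0 < 1 + u by rewrite ltr_pwDl.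
  rewrite in_itv/= lerBlDl lerBrDl; apply/andP; split.
    by rewrite -(invrK (1 + u)) lef_pV2// posrE invr_gt0.
  by rewrite -(invrK (1 + u)) lef_pV2// posrE invr_gt0.
rewrite in_itv/= lerBlDl lerBrDl => /andP[bu ua].
have u0 : 0 <= u by have := le_trans b1' bu; lra.
have u1 : 0 < 1 + u by rewrite ltr_pwDl.
rewrite /slab/= (ray_tau_g rs)//; apply/andP; split.
  by rewrite -(invrK a) lef_pV2// posrE invr_gt0.
by rewrite -(invrK b) lef_pV2// posrE invr_gt0.
Qed.

Let slab0_closure b : 0 < b -> b <= 1 ->
  slab 0 b = closure (g @` [set u | b^-1 - 1 <= u]).
Proof.
move=> b0 b1; have b1' : 1 <= b^-1 by rewrite invf_ge1.
apply/seteqP; split=> y.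
  rewrite /slab/= => /andP[_ yb].
  have [[z ->]|[u u0 yE]] := ray_cases rs y; first exact: ray_dense_end.
  apply: subset_closure; exists u => //=.
  move: yb; rewrite yE (ray_tau_g rs)// => ub.
  have u1 : 0 < 1 + u by rewrite ltr_pwDl.
  by rewrite lerBlDl -(invrK (1 + u)) lef_pV2// posrE invr_gt0.
rewrite closureE /=; apply; split; first exact: slab_closed.
move=> _ [u /= bu <-]; rewrite /slab/= tau_ge0/=.
have u0 : 0 <= u by apply: le_trans bu; rewrite subr_ge0.
have u1 : 0 < 1 + u by rewrite ltr_pwDl.
by rewrite (ray_tau_g rs)// -(invrK b) lef_pV2// ?posrE ?invr_gt0// -lerBlDl.
Qed.

Let ray_tail_connected v : connected (g @` [set u | v <= u]).
Proof.
apply: connected_continuous_connected; last exact/continuous_subspaceT/(ray_g_cont rs).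
by apply/connected_intervalP => a b /= va vb c /andP[ac _]; exact: le_trans ac.
Qed.

Let slab_subcontinuum a b : 0 <= a -> a <= b -> 0 < b -> b <= 1 ->
  subcontinuum (slab a b).
Proof.
move=> a0 ab b0 b1; have b1' : 1 <= b^-1 by rewrite invf_ge1.
split.
- exists (g (b^-1 - 1)); rewrite /slab/= (ray_tau_g rs) ?subr_ge0//.
  by rewrite addrC subrK invrK ab lexx.
- by apply: (subclosed_compact (@slab_closed a b) ray_space_compact).
- move: a0; rewrite le_eqVlt => /predU1P[<-|a0].
    by rewrite slab0_closure//; exact/connected_closure/ray_tail_connected.
  by rewrite slab_seg//; exact: seg_connected.
Qed.

(** [tau] maps [P] onto an interval and is injective on the ray, so [P] contains every ray point
    with value in that interval. If the minimum is 0, these points form a tail of the ray; its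
    closure contains [X], and [P] is closed. *)
Lemma subcontinuum_slab P y : subcontinuum P -> P y -> 0 < tau y -> exists a b,
  [/\ 0 <= a, a <= b, 0 < b, b <= 1 & P = slab a b].
Proof.
move=> [P0 cP ctP] Py y0.
have tP : {within P, continuous tau} by exact: continuous_subspaceT.
have [ya /set_mem Pya aP] := compact_EVT_min P0 cP tP.
have [yb /set_mem Pyb bP] := compact_EVT_max P0 cP tP.
have {}aP t : P t -> tau ya <= tau t by move=> Pt; apply: aP; exact: mem_set.
have {}bP t : P t -> tau t <= tau yb by move=> Pt; apply: bP; exact: mem_set.
have b0 : 0 < tau yb := lt_le_trans y0 (bP _ Py).
have Pslab t : tau ya <= tau t <= tau yb -> 0 < tau t -> P t.
  move=> tab t0; have /connected_intervalP/(_ (tau ya) (tau yb)) :=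
    connected_continuous_connected ctP tP.
  move=> /(_ (ex_intro2 _ _ _ Pya erefl) (ex_intro2 _ _ _ Pyb erefl) _ tab)[t' Pt' tt'].
  by rewrite (tau_inj t0 (esym tt')).
exists (tau ya), (tau yb); split => //; first exact: aP.
apply/seteqP; split=> [t Pt|t]; first by rewrite /slab/= aP// bP.
rewrite /slab/= => tab; have [t0|t0] := ltP 0 (tau t); first exact: Pslab.
have ya0 : tau ya = 0.
  by apply/eqP; rewrite eq_le tau_ge0 andbT; case/andP: tab => /le_trans ->.
have : slab 0 (tau yb) t by rewrite /slab/= tau_ge0/=; case/andP: tab.
rewrite slab0_closure// => clt.
have : closed P by apply: compact_closed => //; exact: metric_hausdorff.
apply; apply: closureS clt => _ [u /= bu <-].
have b1' : 1 <= (tau yb)^-1 by rewrite invf_ge1.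
have u0 : 0 <= u by apply: le_trans bu; rewrite subr_ge0.
apply: Pslab; last exact: tau_g_gt0.
have u1 : 0 < 1 + u by rewrite ltr_pwDl.
rewrite ya0 tau_ge0/= (ray_tau_g rs)// -(invrK (tau yb)) lef_pV2// ?posrE ?invr_gt0//.
by rewrite -lerBlDl.
Qed.

(** Turns closeness of [tau] values into closeness of points, uniformly by compactness: a point
    outside the slab has its value at a positive distance from the interval, and [tau] is
    1-Lipschitz. *)
Lemma slab_near a b e : 0 < e -> exists2 d, 0 < d &
  forall y, a - d < tau y < b + d -> exists2 k, slab a b k & mdist y k < e.
Proof.
move=> e0; have /compact_near_coveringP := ray_space_compact.
move=> /(_ R (0^'+) (fun d y => a - d < tau y < b + d -> exists2 k, slab a b k & mdist y k < e)).
case.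
  move=> y _; have [ys|ys] := pselect (slab a b y).
    near=> y' d => _; exists y => //.
    have : ball y e y' by near: y'; exact: nbhsx_ballx.
    by rewrite ballEmdist/= metric_sym.
  have [d d0 hd] : exists2 d, 0 < d & (tau y + d + d <= a \/ b + d + d <= tau y).
    have [ya|ay] := ltP (tau y) a.
      by exists ((a - tau y) / 2); [rewrite divr_gt0// subr_gt0|left; lra].
    have [by_|yb] := ltP b (tau y).
      by exists ((tau y - b) / 2); [rewrite divr_gt0// subr_gt0|right; lra].
    by exfalso; apply: ys; rewrite /slab/= ay yb.
  near=> y' d'.
  have : ball y d y' by near: y'; exact: nbhsx_ballx.
  rewrite ballEmdist/= => yy'; have := ray_tau_lip rs y y'.
  have d'd : d' < d by near: d'; exact: nbhs_right_lt.
  rewrite ler_norml => /andP[h1 h2] /andP[h3 h4]; exfalso.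
  by case: hd => h; lra.
move=> d /= d0 h; exists (d / 2); first by rewrite divr_gt0.
move=> y; apply: (h (d / 2)) => //=; last by rewrite divr_gt0.
by rewrite sub0r normrN gtr0_norm ?divr_gt0// ltr_pdivrMr// ltr_pMr// ltr1n.
Unshelve. all: by end_near. Qed.

(** * Maximal limit continua in the ray space *)

Lemma maximal_limit_continuum_ray K L y : subcontinuum K -> K y -> 0 < tau y ->
  maximal_limit_continuum K L -> L = K.
Proof.
move=> sK Ky y0 [sL LK [L_ [sL_ L_L maxL]]].
have [a [b [a0 ab b0 b1 KE]]] := subcontinuum_slab sK Ky y0.
have tL n : exists ab : R * R, [/\ forall p, L_ n p -> ab.1 <= tau p <= ab.2,
    exists2 p, L_ n p & tau p = ab.1 & exists2 p, L_ n p & tau p = ab.2].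
  have [P0 cP _] := sL_ n; have tP := continuous_subspaceT (A := L_ n) tau_cont.
  have [ya /set_mem Pya aP] := compact_EVT_min P0 cP tP.
  have [yb /set_mem Pyb bP] := compact_EVT_max P0 cP tP.
  exists (tau ya, tau yb); split => /=; [|by exists ya|by exists yb].
  by move=> p /mem_set Pp; rewrite aP// bP.
have {tL}[ab_ tL] := choice tL.
(* The smallest slab containing both [K] and [L_ n]. The values of [tau] on [L_ n] approach those on
   [L], hence the interval of [K], so these growths of [L_ n] converge to [K] and maximality forces
   [L] to be [K]. *)
pose S n := slab (Num.min a (ab_ n).1) (Num.max b (ab_ n).2).
have sS n : subcontinuum (S n).
  have [_ [p _ pE] [q _ qE]] := tL n; apply: slab_subcontinuum.
  - by rewrite le_min a0 -pE tau_ge0.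
  - by rewrite ge_min le_max ab.
  - by rewrite lt_max b0.
  - by rewrite ge_max b1 -qE tau_le1.
have KS n : K `<=` S n.
  move=> t; rewrite KE /S /slab/= => /andP[at_ tb].
  by rewrite ge_min at_/= le_max tb.
have S_K : hausdorff_cvg S K.
  apply/hausdorff_cvgP; [exact: ray_space_compact|by move=> n; case: (sS n)|by case: sK|].
  move=> e e0; have [d d0 hd] := slab_near a b e0.
  have /hausdorff_cvgP/(_ _ d0) := L_L.
  move=> /(_ ray_space_compact (fun n => let: And3 h _ _ := sL_ n in h)).
  move=> /(_ (let: And3 h _ _ := sL in h)); apply: filterS => n [h _].
  split; last by move=> t Kt; exists t; [exact: KS|rewrite mdistxx].
  have near_ab p : L_ n p -> a - d < tau p < b + d.
    move=> /h[l /LK]; rewrite KE /slab/= => /andP[al lb] /(le_lt_trans (ray_tau_lip rs _ _)).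
    by rewrite ltr_norml => /andP[]; lra.
  have [_ [p Lp pE] [q Lq qE]] := tL n.
  move: (near_ab _ Lp) (near_ab _ Lq); rewrite pE qE => /andP[p1 _] /andP[_ q2].
  move=> t; rewrite /S /slab/= => /andP[h1 h2].
  have [k kab tk] : exists2 k, slab a b k & mdist t k < e.
    apply: hd; apply/andP; split.
      by apply: lt_le_trans h1; rewrite lt_min p1 andbT ltrBlDr ltrDl.
    by apply: le_lt_trans h2 _; rewrite gt_max q2 andbT ltrDl.
  by exists k; rewrite ?KE.
apply/esym/(maxL S K) => // n p Lp; have [/(_ p Lp)/andP[h1 h2] _ _] := tL n.
by rewrite /S /slab/= ge_min h1 orbT le_max h2 orbT.
Qed.

Let image_subcontinuum A : subcontinuum A -> subcontinuum (i @` A).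
Proof.
move=> [[a Aa] cA ctA]; split; first by exists (i a), a.
  by apply: continuous_compact => //; exact: continuous_subspaceT.
by apply: connected_continuous_connected => //; exact: continuous_subspaceT.
Qed.

Let preimage_subcontinuum P : subcontinuum P -> P `<=` range i ->
  subcontinuum (i @^-1` P) /\ i @` (i @^-1` P) = P.
Proof.
move=> [[p Pp] cP ctP] Pi; have rP : {within P, continuous r}.
  exact: continuous_subspaceW r_within.
have -> : i @^-1` P = r @` P.
  apply/seteqP; split=> [z Pz|_ [q Pq <-]]; first by exists (i z); rewrite ?(ray_r_i rs).
  by have [z _ zq] := Pi _ Pq; rewrite /= -zq (ray_r_i rs) zq.
split; first split.
- by exists (r p), p.
- exact: continuous_compact.
- exact: connected_continuous_connected.
apply/seteqP; split=> [_ [_ [q Pq <-] <-]|q Pq].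
  by have [z _ zq] := Pi _ Pq; rewrite -zq (ray_r_i rs) zq.
by exists (r q); [exists q|have [z _ <-] := Pi _ Pq; rewrite (ray_r_i rs)].
Qed.

Let image_hclose e A B : hclose e (i @` A) (i @` B) <-> hclose e A B.
Proof.
split=> -[h1 h2]; split.
- move=> a Aa; have [|_ [b Bb <-]] := h1 (i a); first by exists a.
  by rewrite (ray_iso rs) => ab; exists b.
- move=> b Bb; have [|_ [a Aa <-]] := h2 (i b); first by exists b.
  by rewrite (ray_iso rs) => ab; exists a.
- move=> _ [a Aa <-]; have [b Bb ab] := h1 _ Aa.
  by exists (i b); [exists b|rewrite (ray_iso rs)].
- move=> _ [b Bb <-]; have [a Aa ab] := h2 _ Bb.
  by exists (i a); [exists a|rewrite (ray_iso rs)].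
Qed.

(** The ray is within [w] of the sequence, possibly with equality; the factor 2 makes the inequality
    strict. *)
Let seg_hclose u v : 0 <= u -> u <= v -> hclose (2 * w (Num.truncn u))
  (i @` (x @` [set t | (Num.truncn u <= t <= Num.truncn v)%N])) (seg u v).
Proof.
move=> u0 uv; have near_ s : u <= s -> mdist (g s) (i (x (Num.truncn s))) < 2 * w (Num.truncn u).
  move=> us; apply: le_lt_trans (ray_near rs (le_trans u0 us)) _.
  apply: (@le_lt_trans _ _ (w (Num.truncn u))); first exact/(shadow_mono sh)/le_truncn.
  by rewrite ltr_pMl// ltr1n.
split=> [_ [_ [t /= /andP[ut tv] <-] <-]|_ [s /= + <-]]; last first.
  rewrite in_itv/= => /andP[us sv]; exists (i (x (Num.truncn s))).
    by exists (x (Num.truncn s)) => //; exists (Num.truncn s) => //=; rewrite !le_truncn.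
  by rewrite metric_sym near_.
(* For the first index, [t%:R] may lie below [u]; then [u] itself has integer part [t]. *)
pose s := Num.max u t%:R; have us : u <= s by rewrite le_max lexx.
exists (g s).
  exists s => //=; rewrite in_itv/= us ge_max uv/=.
  apply: le_trans (_ : (Num.truncn v)%:R <= _); first by rewrite ler_nat.
  by rewrite truncn_le (le_trans u0).
rewrite metric_sym; suff <- : Num.truncn s = t by exact: near_.
rewrite /s /Num.max; case: ifPn => [_|]; first exact: natrK.
rewrite -leNgt => /(le_truncn (R := R)); rewrite natrK => tu; lia.
Qed.

(** The 3 adds the error [w] between a subcontinuum of [X] and the sequence to the error [2 * w]
    between the sequence and the ray. *)
Let small e P := forall u, 0 <= u -> P (g u) -> 3 * w (Num.truncn u) < e.

Lemma ray_space_transfer P : subcontinuum P -> exists A, [/\ subcontinuum A,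
  forall e, 0 < e -> small e P -> hclose e (i @` A) P &
  forall A', subcontinuum A' -> A `<=` A' -> exists P', [/\ subcontinuum P', P `<=` P' &
    forall e, 0 < e -> small e P -> hclose e (i @` A') P']].
Proof.
move=> sP; have [[y [Py y0]]|nP] := pselect (exists y, P y /\ 0 < tau y); last first.
  have Pi : P `<=` range i.
    move=> y Py; exists (r y) => //; apply/esym/tau_eq0/eqP.
    rewrite eq_le tau_ge0 andbT leNgt; apply/negP => y0; apply: nP; by exists y.
  have [sA AE] := preimage_subcontinuum sP Pi.
  exists (i @^-1` P); rewrite AE; split=> // [e e0 _|A' sA' AA']; first exact: hclose_refl.
  exists (i @` A'); split; first exact: image_subcontinuum.
    by rewrite -[X in X `<=` _]AE; exact: image_subset.
  by move=> e e0 _; exact: hclose_refl.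
have [a [b [a0 ab b0 b1 PE]]] := subcontinuum_slab sP Py y0.
have [cX ctX [x1 _]] := contX.
move: a0; rewrite le_eqVlt => /predU1P[a0|a0].
  have iP z : P (i z) by rewrite PE /slab/= (ray_tau_i rs) -a0 lexx ltW.
  have h e : 0 < e -> small e P -> hclose e (range i) P.
    move=> e0 eP; split=> [_ [z _ <-]|p Pp]; first by exists (i z); rewrite // mdistxx.
    have [[z pE]|[u u0 pE]] := ray_cases rs p.
      by exists p; rewrite ?mdistxx//; exists z.
    exists (i (x (Num.truncn u))); first by exists (x (Num.truncn u)).
    rewrite metric_sym pE; apply: le_lt_trans (ray_near rs u0) _.
    apply: le_lt_trans (eP u u0 _); last by rewrite -pE.
    by rewrite ler_peMl ?ler1n// ltW.
  exists [set: X]; split => //; first by split => //; exists x1.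
  move=> A' _ TA'; exists P; split => //.
  by rewrite (_ : A' = setT)//; apply/seteqP; split.
have {}PE : P = seg (b^-1 - 1) (a^-1 - 1) by rewrite PE slab_seg.
have : b^-1 - 1 <= a^-1 - 1 by rewrite lerD2r lef_pV2.
have : 0 <= b^-1 - 1 by rewrite subr_ge0 invf_ge1.
move: (b^-1 - 1) (a^-1 - 1) PE => u v PE u0 uv.
have v0 := le_trans u0 uv; set k := Num.truncn u; set l := Num.truncn v.
have kl : (k <= l)%N by exact: le_truncn.
have smallE e : small e P -> w k + 2 * w k <= e.
  move=> /(_ u u0); rewrite -/k => h; rewrite -[X in X + _]mul1r -mulrDl.
  rewrite (_ : 1 + 2 = 3 :> R); last by ring.
  by apply/ltW/h; rewrite PE; exists u => //=; rewrite in_itv/= lexx.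
have [A [sA hA gA]] := shadow_growth sh kl.
exists A; split => // [e e0 /smallE eP|A' sA' AA'].
  apply: (hclose_le eP); apply: hclose_trans; first by apply/image_hclose; exact: hA.
  by rewrite PE; exact: seg_hclose.
have [k' [l' [k'k ll' wk' hA']]] := gA _ sA' AA'.
(* The new arc must contain the old one and have integer parts [k'] and [l'] at its ends; the
   maximum achieves this also when [l'] equals [l]. *)
pose u' : R := k'%:R; pose v' := Num.max v l'%:R.
have u'0 : 0 <= u' by rewrite ler0n.
have u'u : u' <= u by apply: le_trans (_ : k%:R <= _); rewrite ?ler_nat// truncn_le.
have vv' : v <= v' by rewrite le_max lexx.
have u'v' : u' <= v' by exact: le_trans (le_trans uv vv').
have v'l' : Num.truncn v' = l'.
  rewrite /v' /Num.max; case: ifPn => [_|]; first exact: natrK.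
  rewrite -leNgt => /(le_truncn (R := R)); rewrite natrK -/l => l'l; lia.
exists (seg u' v'); split.
- split; [|exact: seg_compact|exact: seg_connected].
  by exists (g u'), u' => //=; rewrite in_itv/= lexx.
- rewrite PE => _ [s /= + <-]; rewrite in_itv/= => /andP[us sv]; exists s => //=.
  by rewrite in_itv/= (le_trans u'u us) (le_trans sv vv').
move=> e e0 /smallE eP; apply: (hclose_le eP).
apply: hclose_trans; first by apply/image_hclose; exact: hA'.
have := seg_hclose u'0 u'v'; rewrite v'l' natrK; apply: hclose_le.
by rewrite ler_pM2l.
Qed.

Let smallP e : 0 < e -> exists2 d, 0 < d & forall P,
  (forall p, P p -> tau p < d) -> small e P.
Proof.
move=> e0; have [d d0 hd] := tau_small (divr_gt0 e0 (ltr0n R 3)); exists d => // P hP u u0.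
by move=> /hP/(hd _ u0); rewrite ltr_pdivlMr// mulrC.
Qed.

(** A convergent growth [B_] of the shadows [A_] with limit in [K] yields a growth [P_] of [L_] with
    the same limit, to which the maximality of [L] applies. *)
Lemma maximal_limit_continuum_preimage K L : subcontinuum K -> K `<=` range i ->
  maximal_limit_continuum K L ->
  maximal_limit_continuum (i @^-1` K) (i @^-1` L) /\ i @` (i @^-1` L) = L.
Proof.
move=> sK Ki [sL LK [L_ [sL_ L_L maxL]]].
have [cX _ _] := contX; have cY := ray_space_compact.
have [sA AE] := preimage_subcontinuum sL (subset_trans LK Ki).
have L_0 n : L_ n !=set0 by case: (sL_ n).
have L0 : L !=set0 by case: sL.
move/hausdorff_cvgP : (L_L) => /(_ cY L_0 L0) cvgL.
split => //; split => //; first by move=> z Lz; exact: LK.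
have /choice[A_ hA] : forall n, exists A, _ := fun n => ray_space_transfer (sL_ n).
have A_0 n : A_ n !=set0 by case: (hA n) => -[].
(* The limit [L] lies in [X], so [tau] tends to 0 uniformly on [L_ n] and the shadowing errors
   vanish. *)
have evsmall e : 0 < e -> \forall n \near \oo, small e (L_ n).
  move=> e0; have [d d0 hd] := smallP e0; apply: filterS (cvgL _ d0) => n [h _].
  apply: hd => p /h[q /LK/Ki[z _ <-]] /(le_lt_trans (ray_tau_lip rs _ _)).
  by rewrite (ray_tau_i rs) subr0 ger0_norm.
exists A_; split.
- by move=> n; case: (hA n).
- apply/hausdorff_cvgP => //; first by case: sA.
  move=> e e0; have e20 : 0 < e / 2 by rewrite divr_gt0.
  near=> n; apply/image_hclose; rewrite AE (splitr e).
  apply: (@hclose_trans _ _ (L_ n)); last by near: n; exact: cvgL.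
  by have [_ + _] := hA n; apply => //; near: n; exact: evsmall.
- move=> B_ B sB_ sB cvgB AB BK.
  have /choice[P_ hP] : forall n, exists P, _ :=
    fun n => let: And3 _ _ h := hA n in h _ (sB_ n) (AB n).
  have B_0 n : B_ n !=set0 by case: (sB_ n).
  have B0 : B !=set0 by case: sB.
  have P_0 n : P_ n !=set0 by case: (hP n) => -[].
  move/hausdorff_cvgP : cvgB => /(_ cX B_0 B0) cvgB.
  have iB0 : i @` B !=set0 by case: B0 => z Bz; exists (i z), z.
  suff iBL : i @` B = L.
    by rewrite -iBL; apply/seteqP; split=> [z Bz|z [_ /[swap] /i_inj <-]//]; exists z.
  apply: (maxL P_) => //.
  + by move=> n; case: (hP n).
  + exact: image_subcontinuum.
  + apply/hausdorff_cvgP => // e e0; have e20 : 0 < e / 2 by rewrite divr_gt0.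
    near=> n; rewrite (splitr e); apply: (@hclose_trans _ _ (i @` B_ n)).
      apply: hclose_sym; have [_ _] := hP n; apply => //.
      by near: n; exact: evsmall.
    by apply/image_hclose; near: n; exact: cvgB.
  + by move=> n; case: (hP n).
  + by move=> _ [z Bz <-]; exact: BK.
Unshelve. all: by end_near. Qed.

Lemma ray_space_continuum : continuum Y.
Proof.
have [_ _ [z [z' zz']]] := contX; split; first exact: ray_space_compact.
  have [_ _] := slab_subcontinuum (lexx 0) ler01 ltr01 (lexx 1).
  by rewrite (_ : slab 0 1 = setT)//; apply/seteqP; split=> // y _; rewrite /slab/= tau_ge0 tau_le1.
by exists (i z), (i z'); apply: contra zz' => /eqP/i_inj ->.
Qed.

Lemma ray_space_semi_kelley : semi_kelley X -> semi_kelley Y.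
Proof.
move=> [_ skX]; split; first exact: ray_space_continuum.
move=> K sK L M maxL maxM.
have [[y [Ky y0]]|nK] := pselect (exists y, K y /\ 0 < tau y).
  left; rewrite (maximal_limit_continuum_ray sK Ky y0 maxL).
  by rewrite (maximal_limit_continuum_ray sK Ky y0 maxM).
have Ki : K `<=` range i.
  move=> y Ky; exists (r y) => //; apply/esym/tau_eq0/eqP.
  by rewrite eq_le tau_ge0 andbT leNgt; apply/negP => y0; apply: nK; exists y.
have [maxL' <-] := maximal_limit_continuum_preimage sK Ki maxL.
have [maxM' <-] := maximal_limit_continuum_preimage sK Ki maxM.
have [sK' _] := preimage_subcontinuum sK Ki.
by have [h|h] := skX _ sK' _ _ maxL' maxM'; [left|right]; exact: image_subset.
Qed.

Lemma ray_space_compactification : compactification_Ioc01 ray (range i).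
Proof.
split; [exact: ray_space_continuum| |exact: ray_dense| |].
- exists (fun t => g (t^-1 - 1)), tau; split.
  + apply: within_continuous_comp; first by move=> t _; exact: (ray_g_cont rs).
    apply: (@within_continuousD R R R^o); last exact/continuous_subspaceT/cst_continuous.
    apply/continuous_in_subspaceT => t; rewrite inE/= in_itv/= => /andP[t0 _].
    by apply: inv_continuous; rewrite gt_eqF.
  + exact: continuous_subspaceT.
  + move=> _ [t /= + <-]; rewrite in_itv/= => /andP[t0 t1].
    by exists (t^-1 - 1) => //=; rewrite subr_ge0 invf_ge1.
  + move=> _ [_ [u /= u0 <-] <-]; rewrite in_itv/= tau_le1 andbT; exact: tau_g_gt0.
  + split=> [t|_ [u /= u0 <-]].
      rewrite /= in_itv/= => /andP[t0 t1].
      by rewrite (ray_tau_g rs) ?subr_ge0 ?invf_ge1// addrC subrK invrK.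
    by rewrite (ray_tau_g rs)// invrK addrC addKr.
- apply/seteqP; split=> // y _.
  by have [[z ->]|[u u0 ->]] := ray_cases rs y; [right; exists z|left; exists u].
- apply/seteqP; split=> // _ [[u /= u0 <-] [z _ /(congr1 tau)]].
  by rewrite (ray_tau_i rs) => h; have := tau_g_gt0 u0; rewrite -h ltxx.
Qed.

Lemma ray_space_remainder : homeomorphic [set: X] (range i).
Proof.
exists i, r; split => //; first exact: continuous_subspaceT.
- by split=> [z _|_ [z _ <-]]; rewrite (ray_r_i rs).
Qed.

End ray_space_theory.

Theorem theorem4p3 (R : realType) (X : metricType R) :
  chainable X -> semi_kelley X -> semi_kelley_remainder X.
Proof.
move=> chX skX; have [contX _] := chX; have [cX _ _] := contX; split => //.
have [x [w sh]] := chainable_shadowed_sequence chX.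
have [D D0 hD] := compact_mdist_bounded cX.
have [Y [i [g [tau [r rs]]]]] := ray_space_exists D0 hD (shadow_inv sh) (shadow_step sh).
exists Y, (g @` [set u | 0 <= u]), (range i); split.
- exact: ray_space_compactification rs sh contX.
- exact: ray_space_semi_kelley rs sh contX skX.
- exact: ray_space_remainder rs.
Qed.
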